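(* We have $$R(k,\ell) \le e^{-\ell/50 + o(k)} \binom{k + \ell}{\ell}$$ for every $k,\ell \in \mathbb{N}$ with $\ell \le 2k/3$.
   Context: The Ramsey number $R(k,\ell)$ is the minimum $n \in \mathbb{N}$ such that every red-blue colouring of the edges of the complete graph $K_n$ contains either a red copy of $K_k$ or a blue copy of $K_\ell$. The term $o(k)$ denotes a function of $k$ only (uniform over all admissible $\ell$) which, divided by $k$, tends to $0$ as $k \to \infty$. *)

(* Defs.v *)
From mathcomp Require Import all_boot.

Set Implicit Arguments.
Unset Strict Implicit.
Unset Printing Implicit Defensive.

Definition edge (n : nat) := {e : {set 'I_n} | #|e| == 2}.

(* A red-blue colouring of the edges of K_n: [true] is red, [false] is blue. *)
Definition colouring (n : nat) := {ffun edge n -> bool}.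

Definition monochromatic (n : nat) (c : colouring n) (b : bool)
    (S : {set 'I_n}) : bool :=
  [forall e : edge n, (val e \subset S) ==> (c e == b)].

Definition has_clique (n : nat) (c : colouring n) (b : bool) (k : nat) : bool :=
  [exists S : {set 'I_n}, (#|S| == k) && monochromatic c b S].

Definition arrows (k l n : nat) : bool :=
  [forall c : colouring n, has_clique c true k || has_clique c false l].

Lemma monochromatic0 (n : nat) (c : colouring n) b : monochromatic c b set0.
Proof.
apply/forallP => -[e he] /=; apply/implyP; rewrite subset0 => /eqP e0.
by exfalso; move: he; rewrite e0 cards0.
Qed.

Definition nbr (n : nat) (c : colouring n) (b : bool) (x : 'I_n) : {set 'I_n} :=
  [set y | [exists e : edge n, (val e == [set x; y]) && (c e == b)]].

Lemma monochromaticU1 (n : nat) (c : colouring n) b x (S : {set 'I_n}) :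
  S \subset nbr c b x -> monochromatic c b S -> monochromatic c b (x |: S).
Proof.
move=> /subsetP Sx /forallP mS; apply/forallP => e; apply/implyP => eS.
have e2 : #|val e| == 2 by exact: (valP e).
have [u [v [uv De]]] : exists u v, u != v /\ val e = [set u; v] by apply/cards2P.
case: (boolP (val e \subset S)) => [eS'|neS]; first by have := mS e; rewrite eS'.
have: (u \in x |: S) && (v \in x |: S).
  by rewrite !(subsetP eS) // De !inE eqxx ?orbT.
have main y : y \in S -> val e = [set x; y] -> c e == b.
  move=> /Sx; rewrite inE => /existsP[e' /andP[/eqP De' ce']] Dxy.
  by have -> : e = e' by apply: val_inj; rewrite Dxy De'.
rewrite !in_setU1 => /andP[/orP[/eqP ux|uS] /orP[/eqP vx|vS]].
- by move: uv; rewrite ux vx eqxx.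
- by apply: (main v); rewrite // De ux.
- by apply: (main u); rewrite // De vx setUC.
- by move: neS; rewrite De subUset !sub1set uS vS.
Qed.

Lemma ramsey_in (n : nat) (c : colouring n) m k l (A : {set 'I_n}) :
  k + l = m -> 2 ^ m <= #|A| ->
  (exists S : {set 'I_n}, [/\ S \subset A, #|S| = k & monochromatic c true S])
  \/ (exists S : {set 'I_n}, [/\ S \subset A, #|S| = l & monochromatic c false S]).
Proof.
elim: m k l A => [|m IHm] [|k] [|l] A // klm leA; try by
  left; exists set0; rewrite sub0set cards0 monochromatic0.
  by right; exists set0; rewrite sub0set cards0 monochromatic0.
have /card_gt0P[x xA] : 0 < #|A| by apply: leq_trans leA; rewrite expn_gt0.
pose B b := (A :\ x) :&: nbr c b x.
have AB : A :\ x \subset B true :|: B false.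
  apply/subsetP => y yA; rewrite /B -setIUr inE yA /=.
  have xy : #|[set x; y]| == 2.
    by move: yA; rewrite !inE cards2 eq_sym => /andP[->].
  pose e : edge n := Sub [set x; y] xy.
  have ye : y \in nbr c (c e) x by rewrite inE; apply/existsP; exists e; rewrite !eqxx.
  by move: ye; rewrite in_setU; case: (c e) => ->; rewrite ?orbT.
have cAB : 2 ^ m.+1 <= (#|B true| + #|B false|).+1.
  apply: (leq_trans leA); rewrite (cardsD1 x) xA add1n ltnS.
  by rewrite (leq_trans (subset_leq_card AB)) // cardsU leq_subr.
have BA b : B b \subset A.
  by rewrite (subset_trans (subsetIl _ _)) // subsetDl.
have extend b (S : {set 'I_n}) : S \subset B b -> monochromatic c b S ->
  [/\ x |: S \subset A, #|x |: S| = #|S|.+1 & monochromatic c b (x |: S)].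
  move=> SB mS; split.
  - by rewrite subUset sub1set xA (subset_trans SB).
  - rewrite cardsU1; case: (boolP (x \in S)) => // /(subsetP SB).
    by rewrite !inE eqxx.
  - by apply: monochromaticU1 => //; apply: subset_trans SB (subsetIr _ _).
have [lt|le] := leqP (2 ^ m) #|B true|.
  have [||[S [SB <- mS]]|[S [SB cS mS]]] := IHm k l.+1 (B true) => //.
  - by move: klm; rewrite addSn => -[].
  - by left; exists (x |: S); apply: extend.
  - by right; exists S; split=> //; apply: subset_trans SB (BA _).
have le' : 2 ^ m <= #|B false|.
  move: cAB; rewrite expnS mul2n -addnn => cAB.
  rewrite leqNgt; apply/negP => lt.
  by have := leq_trans (leq_add le lt) cAB; rewrite addSn addnS ltnn.
have [||[S [SB cS mS]]|[S [SB <- mS]]] := IHm k.+1 l (B false) => //.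
- by move: klm; rewrite addnS => -[].
- by left; exists S; split=> //; apply: subset_trans SB (BA _).
- by right; exists (x |: S); apply: extend.
Qed.

Lemma arrows_exists (k l : nat) : exists n, arrows k l n.
Proof.
exists (2 ^ (k + l)); apply/forallP => c.
have [|[S [_ cS mS]]|[S [_ cS mS]]] := @ramsey_in _ c _ k l [set: _] erefl.
- by rewrite cardsT card_ord.
- by apply/orP; left; apply/existsP; exists S; rewrite cS eqxx.
- by apply/orP; right; apply/existsP; exists S; rewrite cS eqxx.
Qed.

Definition ramsey (k l : nat) : nat := ex_minn (arrows_exists k l).

(* Main.v *)
Require Import Defs.
From mathcomp Require Import all_boot all_order all_algebra.
From mathcomp Require Import ring lra.
Import Order.TTheory GRing.Theory Num.Theory.

(** For two sets [X] and [Y] of vertices, not necessarily disjoint, let the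
    excess be the number of red pairs of [X * Y] beyond [p * |X| * |Y|].  The
    proof follows a pair with positive excess while cliques are built: a red
    clique that is joined in red to all that remains, and a blue clique that is
    joined in blue to what remains of [X].

    The engine is [book_argument].  By Cauchy-Schwarz ([excess_average]) some
    vertex [v] of [X] keeps, inside [Y' = Y :&: N_red(v)], at least the average
    density from [X] to [Y'].  This density splits between the red and the blue
    neighbourhoods of [v] in [X].  If the red one gets its share, [v] extends
    the red clique (red step); otherwise the density from the blue one to [Y']
    is boosted and [v] extends the blue clique (boost step).  Progress is
    measured by

      [excess ^ (m + 1) / (|X| * |Y|) ^ m = |X| * |Y| * d ^ (m + 1)],

    where [d] is the density surplus over [p].  With [m] large a tiny gain of
    density makes up for a large loss of vertices, and the result
    ([red_or_boost]) is that a red step costs at most a factor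
    [x = (1 - mu) * q ^ (m + 1)], close to [(1 - mu) * p ^ (1 / (1 - mu))], and
    a blue step at most [mu].  This requires the blue degree of [v] in [X] to be
    at most about [mu * |X|].  If too many vertices have a larger blue degree,
    they contain a large blue clique, some [r] vertices of which have at least
    about [mu ^ r * |X|] common blue neighbours ([book_step]).  When [X] is
    exhausted, what remains of [Y] is at least [x ^ - k * y ^ - l], where
    [y = 1 - x], and the Erdos-Szekeres bound finishes.  Hence a set [A] with
    red density above [p] contains a red clique of size [k] or a blue clique of
    size [l] as soon as [|A| ^ 2 >= x ^ - k * (mu * y) ^ - l], up to a factor
    [exp (o(k))] ([red_dense_set], used with [X = Y = A]).

    It remains to supply the density, by induction on [l] for fixed [k]
    ([ramsey_bound_in_set]).  Let [g = l / (k + l)].  Either the blue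
    neighbourhood of some vertex is large enough for the pair [(k, l - 1)], or
    all blue degrees in [A] are at most [exp (1 / 50) * g * |A|], so that the
    red density is at least [1 - exp (1 / 50) * g].  Take [mu = g].  With
    [t = - ln (1 - g)], up to small errors [- ln p <= t + 0.035 * g] and
    [y >= 1.84 * g >= exp (0.6) * g], and the required
    [|A| ^ 2 >= x ^ - k * (g * y) ^ - l] for
    [|A| = exp (- l / 50) * 'C(k + l, l)] reduces to
    [0.6 - 2 / 50 - 0.035 >= t] ([entropy_bound]); this holds because
    [g <= 2 / 5] gives [t <= - ln (3 / 5) < 0.525].

    All constants depend only on the target error [e], so a loss
    [exp (e * k)] for every [e > 0] is obtained uniformly in [l]. *)

Set Implicit Arguments.
Unset Strict Implicit.
Unset Printing Implicit Defensive.

(** * Cliques inside a set of vertices *)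

Section Cliques.
Variables (n : nat) (c : colouring n).
Implicit Types (x y : 'I_n) (A B S Q X : {set 'I_n}) (b : bool).

Lemma nbrP b x y :
  reflect (exists e : edge n, val e = [set x; y] /\ c e = b) (y \in nbr c b x).
Proof.
rewrite inE; apply: (iffP existsP) => -[e].
  by case/andP => /eqP ? /eqP ?; exists e.
by case=> De ce; exists e; rewrite De ce !eqxx.
Qed.

Lemma nbr_irr b x : x \notin nbr c b x.
Proof.
apply/nbrP => -[e [De _]]; have e2 : #|val e| == 2 by exact: (valP e).
by move: e2; rewrite De setUid cards1.
Qed.

Lemma nbr_sym b x y : (y \in nbr c b x) = (x \in nbr c b y).
Proof. by apply/nbrP/nbrP => -[e [De ce]]; exists e; rewrite setUC. Qed.

Lemma nbr_opp x y : y != x -> (y \in nbr c false x) = (y \notin nbr c true x).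
Proof.
move=> yx; have xy2 : #|[set x; y]| == 2 by rewrite cards2 (eq_sym x) yx.
pose e : edge n := Sub [set x; y] xy2.
have uniq_e e' : val e' = [set x; y] -> e' = e by move=> De'; exact: val_inj.
apply/nbrP/negP => [[e1 [/uniq_e -> ce]] /nbrP[e2 [/uniq_e ->]]|ne]; first by rewrite ce.
by exists e; split=> //; case ce: (c e) => //; case: ne; apply/nbrP; exists e.
Qed.

Lemma mono_nbr b S x y :
  monochromatic c b S -> x \in S -> y \in S -> y != x -> y \in nbr c b x.
Proof.
move=> /forallP mS xS yS yx; have xy2 : #|[set x; y]| == 2 by rewrite cards2 (eq_sym x) yx.
apply/nbrP; exists (Sub [set x; y] xy2); split=> //; apply/eqP.
by apply: (implyP (mS _)); rewrite /= subUset !sub1set xS yS.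
Qed.

Lemma mono_sub b S A : S \subset A -> monochromatic c b A -> monochromatic c b S.
Proof.
move=> SA /forallP mA; apply/forallP => e; apply/implyP => eS.
by apply: (implyP (mA e)); exact: subset_trans SA.
Qed.

Definition clique_in b k A : Prop :=
  exists S, [/\ S \subset A, #|S| = k & monochromatic c b S].

Lemma clique_in_sub b k A B : A \subset B -> clique_in b k A -> clique_in b k B.
Proof. by move=> AB [S [SA cS mS]]; exists S; split=> //; exact: subset_trans AB. Qed.

Lemma clique_in0 b A : clique_in b 0 A.
Proof. by exists set0; rewrite sub0set cards0 monochromatic0. Qed.

Lemma clique_in_leq b j k A : j <= k -> clique_in b k A -> clique_in b j A.
Proof.
move=> jk [S [SA cS mS]].
have /card_gt0P[T] : 0 < #|[set T : {set 'I_n} | T \subset S & #|T| == j]|.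
  by rewrite cards_draws bin_gt0 cS.
rewrite inE => /andP[TS /eqP cT].
by exists T; rewrite (subset_trans TS SA) (mono_sub TS mS).
Qed.

Lemma clique_in_extend b k x A B :
  x \in A -> B \subset A -> B \subset nbr c b x ->
  clique_in b k B -> clique_in b k.+1 A.
Proof.
move=> xA BA Bx [S [SB cS mS]]; have Sx := subset_trans SB Bx.
exists (x |: S); split; last exact: monochromaticU1.
  by rewrite subUset sub1set xA (subset_trans SB).
rewrite cardsU1 cS; case: (boolP (x \in S)) => // /(subsetP Sx).
by rewrite (negPf (nbr_irr b x)).
Qed.

Lemma card_split_nbr x A : x \in A ->
  #|A| = (#|A :&: nbr c true x| + #|A :&: nbr c false x|).+1.
Proof.
move=> xA; rewrite (cardsD1 x) xA add1n; congr _.+1.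
rewrite -(cardsID (nbr c true x) (A :\ x)); congr (_ + _); apply: eq_card => y.
  rewrite !in_setI in_setD1; have [->|//] := eqVneq y x.
  by rewrite (negPf (nbr_irr true x)) !andbF.
have [->|yx] := eqVneq y x.
  by rewrite in_setD in_setD1 in_setI eqxx (negPf (nbr_irr false x)) !andbF.
by rewrite in_setD in_setD1 in_setI nbr_opp // yx /= andbC.
Qed.

Lemma big_split_nbr (V : nmodType) (F : 'I_n -> V) v A : v \in A ->
  (\sum_(x in A) F x = F v + (\sum_(x in A :&: nbr c true v) F x
                             + \sum_(x in A :&: nbr c false v) F x))%R.
Proof.
move=> vA; rewrite (bigD1 v) //= (bigID (mem (nbr c true v))) /=.
congr (_ + (_ + _))%R; apply: eq_bigl => x; rewrite in_setI.
  have [->|_] := eqVneq x v; last by rewrite andbT.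
  by rewrite (negPf (nbr_irr true v)) !andbF.
have [->|xv] := eqVneq x v; last by rewrite andbT nbr_opp.
by rewrite (negPf (nbr_irr false v)) !andbF.
Qed.

(** Pascal's rule: since the two neighbourhoods of a vertex make up the rest of
    [A], one of them meets the bound for its smaller pair. *)
Lemma erdos_szekeres k l A :
  'C(k + l, k) <= #|A| -> clique_in true k A \/ clique_in false l A.
Proof.
elim: {k l}(k + l) {-2}k {-2}l (erefl (k + l)) A => [|m IHm] k l.
  by case: k => //; left; apply: clique_in0.
case: k => [|k]; first by left; apply: clique_in0.
case: l => [|l]; first by right; apply: clique_in0.
move=> klm A; have bA b x : A :&: nbr c b x \subset A by exact: subsetIl.
have bN b x : A :&: nbr c b x \subset nbr c b x by exact: subsetIr.
rewrite addSn binS => leA.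
have /card_gt0P[x xA] : 0 < #|A|.
  by apply: leq_trans leA; rewrite addn_gt0 orbC bin_gt0 leq_addr.
have [red|red] := leqP 'C(k + l.+1, k) #|A :&: nbr c true x|.
  have klm' : k + l.+1 = m by move: klm; rewrite addSn => -[].
  case: (IHm k l.+1 klm' _ red) => S.
    by left; apply: clique_in_extend xA _ _ S.
  by right; apply: clique_in_sub S.
have blue : 'C(k.+1 + l, k.+1) <= #|A :&: nbr c false x|.
  rewrite addSnnS -(leq_add2r 'C(k + l.+1, k)) (leq_trans leA) //.
  by rewrite (card_split_nbr xA) addnC -addnS leq_add2l.
have klm' : k.+1 + l = m by move: klm; rewrite addnS => -[].
case: (IHm k.+1 l klm' _ blue) => S.
  by left; apply: clique_in_sub S.
by right; apply: clique_in_extend xA _ _ S.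
Qed.

Lemma sum_card_nbr b X Q :
  \sum_(u in X) #|nbr c b u :&: Q| = \sum_(s in Q) #|X :&: nbr c b s|.
Proof.
have cardI A B : #|A :&: B| = \sum_(u in A) (u \in B).
  rewrite -sum1_card big_mkcond [RHS]big_mkcond; apply: eq_bigr => u _.
  by rewrite in_setI; case: (u \in A) => //; case: (u \in B).
under eq_bigr => u _ do rewrite setIC cardI.
under [RHS]eq_bigr => s _ do rewrite cardI.
rewrite exchange_big /=; apply: eq_bigr => s _; apply: eq_bigr => u _.
by rewrite nbr_sym.
Qed.

(** One extracts the book one spine vertex at a time: the vertex kept is the
    one that retains most of the sum of the falling factorials, and deleting
    it from the clique lowers by exactly one the degree of each vertex that
    stays.  Summing falling factorials instead of powers means that the
    spine never repeats a vertex. *)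
Lemma blue_book r Q X : Q \subset X -> monochromatic c false Q -> r <= #|Q| ->
  exists X' : {set 'I_n}, [/\ X' \subset X,
    forall j, clique_in false j X' -> clique_in false (j + r) X
  & \sum_(u in X) #|nbr c false u :&: Q| ^_ r <= #|X'| * #|Q| ^ r].
Proof.
elim: r Q X => [|r IHr] Q X QX mQ rQ.
  exists X; split=> // [j|]; first by rewrite addn0.
  by rewrite expn0 muln1 -sum1_card; apply: leq_sum => u _; rewrite ffactn0.
pose d u := #|nbr c false u :&: Q|.
pose F s := \sum_(u in X :&: nbr c false s) (d u).-1 ^_ r.
have /card_gt0P[s' s'Q] : 0 < #|Q| by exact: leq_trans rQ.
case: (@arg_maxnP _ s' (mem Q) F s'Q) => s /= sQ Fmax.
have {}sQ : s \in Q by exact: sQ.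
have sumF : \sum_(u in X) d u ^_ r.+1 <= #|Q| * F s.
  have -> : \sum_(u in X) d u ^_ r.+1 = \sum_(t in Q) F t.
    rewrite /F; under [RHS]eq_bigr => t _.
      under eq_bigl => u do rewrite in_setI.
      rewrite big_mkcondr /=; over.
    rewrite exchange_big /=; apply: eq_bigr => u uX.
    rewrite -big_mkcondr /= sum_nat_const.
    have -> : #|[pred t in Q | u \in nbr c false t]| = d u.
      by apply: eq_card => t; rewrite in_setI nbr_sym andbC.
    by case: (d u) => [|e]; rewrite ?mul0n ?ffact0n // ffactSS.
  rewrite -sum_nat_const; apply: leq_sum => t tQ; exact: Fmax.
have Qs : Q :\ s \subset nbr c false s.
  by apply/subsetP => t /setD1P[ts tQ]; apply: mono_nbr mQ _ _ _.
have cQs : #|Q| = #|Q :\ s|.+1 by rewrite (cardsD1 s) sQ.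
have QsX : Q :\ s \subset X :&: nbr c false s.
  by rewrite subsetI Qs (subset_trans (subsetDl _ _) QX).
case: (IHr (Q :\ s) (X :&: nbr c false s) QsX _ _) => [||X' [X'X ext sumX']].
- by apply: mono_sub mQ; exact: subsetDl.
- by rewrite -ltnS -cQs.
exists X'; split.
- exact: subset_trans X'X (subsetIl _ _).
- move=> j /ext; rewrite addnS.
  by apply: (clique_in_extend (subsetP QX _ sQ)); [exact: subsetIl | exact: subsetIr].
apply: (leq_trans sumF); rewrite expnS mulnCA leq_mul2l; apply/orP; right.
apply: leq_trans (leq_trans sumX' _).
  apply: leq_sum => u; rewrite in_setI => /andP[uX us]; rewrite leq_eqVlt; apply/orP; left.
  apply/eqP; congr (_ ^_ r); rewrite /d (cardsD1 s) in_setI nbr_sym us sQ /=.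
  by apply: eq_card => t; rewrite !(in_setI, in_setD1) andbCA.
rewrite leq_mul2l cQs; apply/orP; right.
by case: (r) => // r'; rewrite leq_exp2r.
Qed.
End Cliques.

Lemma ramsey_pred_colouring k l : 0 < ramsey k l ->
  exists c : colouring (ramsey k l).-1,
    ~ clique_in c true k [set: _] /\ ~ clique_in c false l [set: _].
Proof.
rewrite /ramsey; case: ex_minnP => n _ n_min n0.
have : ~~ arrows k l n.-1.
  by apply/negP => /n_min; rewrite leqNgt prednK // leqnn.
move=> /forallPn[c]; rewrite negb_or => /andP[nred nblue]; exists c.
have no b j : ~~ has_clique c b j -> ~ clique_in c b j [set: _].
  by move=> /existsP nS [S [_ cS mS]]; apply: nS; exists S; rewrite cS eqxx.
by split; apply: no.
Qed.

Local Open Scope ring_scope.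

(** * Convexity of powers *)

Section Bernoulli.
Variable R : realFieldType.

Lemma bernoulli (z : R) m : 0 <= z -> 1 + m%:R * (z - 1) <= z ^+ m.
Proof.
move=> z0; elim: m => [|m IHm]; first by rewrite mul0r addr0 expr0.
rewrite exprS -natr1; apply: le_trans (ler_wpM2l z0 IHm).
have m0 : (0 : R) <= m%:R by [].
have := mulr_ge0 m0 (sqr_ge0 (z - 1)); nra.
Qed.

(** The tangent at [a] of the convex function [z ^+ m]: with this, the
    combinatorial part needs no roots, logarithms or limits. *)
Lemma expr_tangent (a z : R) m : 0 < a -> 0 <= z ->
  a ^+ m * (1 + m%:R * (z / a - 1)) <= z ^+ m.
Proof.
move=> a0 z0; have := bernoulli m (divr_ge0 z0 (ltW a0)).
rewrite -(ler_pM2l (exprn_gt0 m a0)) -exprMn mulrCA divff ?mulr1 //.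
by rewrite gt_eqF.
Qed.

(** AM-GM for [m] copies of [z] and one copy of [1]. *)
Lemma amgm_one (z : R) m : 0 <= z ->
  z ^+ m <= ((m%:R * z + 1) / m.+1%:R) ^+ m.+1.
Proof.
move=> z0; have m0 : (0 : R) < m.+1%:R by [].
move: z0; rewrite le_eqVlt => /predU1P[<-|z0].
  case: m m0 => [|m] _; first by rewrite mulr0 add0r divr1 expr0 expr1.
  by rewrite expr0n /= exprn_ge0 // divr_ge0 // mulr0 add0r.
set u := _ / _.
have u0 : 0 <= u by rewrite divr_ge0 ?addr_ge0 ?mulr_ge0 // ltW.
have := expr_tangent m.+1 z0 u0.
suff -> : z ^+ m.+1 * (1 + m.+1%:R * (u / z - 1)) = z ^+ m by [].
have -> : u / z - 1 = (z^-1 - 1) / m.+1%:R.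
  rewrite /u -natr1; field; by rewrite natr1 !gt_eqF.
rewrite mulrCA divff ?gt_eqF // mulr1 addrC subrK exprSr mulfK //.
by rewrite gt_eqF.
Qed.

End Bernoulli.

(** * Blue books *)

Section Books.
Variables (R : realFieldType) (n : nat) (c : colouring n).
Implicit Types (X Y Q : {set 'I_n}).

Lemma expn_leq_ffact d r : ((d - r) ^ r <= d ^_ r)%N.
Proof.
elim: r d => [|r IHr] d; first by rewrite expn0 ffactn0.
case: d => [|d]; first by rewrite sub0n exp0n.
by rewrite ffactSS subSS expnS leq_mul // (leq_trans (leq_subr _ _)).
Qed.

(** The falling factorial is at least the convex power [(d - r) ^ r], truncated
    at zero, and here replaced by its tangent at [d = a + r].  Summed over the
    vertices, the tangent depends only on the average degree. *)
Lemma ffact_tangent (a : R) d r : 0 < a ->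
  a ^+ r * (1 + r%:R * ((d%:R - r%:R) / a - 1)) <= (d ^_ r)%:R.
Proof.
move=> a0; have [rd|dr] := leqP r d.
  rewrite -natrB //; apply: le_trans (expr_tangent r a0 (ler0n _ _)) _.
  by rewrite -natrX ler_nat expn_leq_ffact.
apply: (@le_trans _ _ 0); last exact: ler0n.
rewrite pmulr_rle0 ?exprn_gt0 //.
have r1 : (1 : R) <= r%:R by rewrite ler1n (leq_ltn_trans _ dr).
have dr' : (d%:R : R) <= r%:R by rewrite ler_nat ltnW.
have w0 : (d%:R - r%:R) / a <= 0 by rewrite pmulr_lle0 ?invr_gt0 // subr_le0.
have := mulr_ge0_le0 (ler0n R r) w0; lra.
Qed.

(** Passing from powers to falling factorials lowers the average degree in [Q]
    from [mu0 * #|Q|] to [mu0 * #|Q| - r]; the gap between [mu0] and [mu1] pays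
    for this. *)
Lemma large_blue_book r (mu0 mu1 : R) Q X :
  Q \subset X -> monochromatic c false Q -> (r <= #|Q|)%N -> (0 < #|Q|)%N -> 0 < mu1 ->
  #|Q|%:R * mu1 + r%:R <= #|Q|%:R * mu0 ->
  (forall s, s \in Q -> mu0 * #|X|%:R <= #|X :&: nbr c false s|%:R) ->
  exists X' : {set 'I_n}, [/\ X' \subset X,
    forall j, clique_in c false j X' -> clique_in c false (j + r) X
  & mu1 ^+ r * #|X|%:R <= #|X'|%:R].
Proof.
move=> QX mQ rQ Q0 mu1_gt0 le_mu degQ.
have [X' [X'X ext sumX']] := blue_book QX mQ rQ.
exists X'; split=> //.
have cQ : (0 : R) < #|Q|%:R by rewrite ltr0n.
pose a := #|Q|%:R * mu1; have a0 : 0 < a by rewrite mulr_gt0.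
suff : a ^+ r * #|X|%:R <= (#|X'| * #|Q| ^ r)%:R.
  rewrite exprMn natrM natrX [#|X'|%:R * _]mulrC -mulrA ler_pM2l //.
  exact: exprn_gt0.
apply: le_trans (_ : (\sum_(u in X) #|nbr c false u :&: Q| ^_ r)%:R <= _); last first.
  by rewrite ler_nat.
rewrite natr_sum.
apply: le_trans (_ : _ <= _) (ler_sum _ (fun u _ => ffact_tangent _ _ a0)).
rewrite -mulr_sumr ler_wpM2l ?exprn_ge0 ?(ltW a0) //.
rewrite big_split /= sumr_const lerDl -mulr_sumr mulr_ge0 //.
rewrite sumrB subr_ge0 sumr_const -mulr_suml ler_pdivlMr //.
rewrite sumrB sumr_const lerBrDr.
have -> : \sum_(u in X) #|nbr c false u :&: Q|%:R
   = \sum_(s in Q) #|X :&: nbr c false s|%:R :> R.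
  by rewrite -!natr_sum sum_card_nbr.
apply: le_trans (ler_sum _ degQ).
rewrite sumr_const -[r%:R *+ _]mulr_natl -[leRHS]mulr_natl.
have X0 : (0 : R) <= #|X|%:R by [].
have := ler_wpM2r X0 le_mu; rewrite /a; lra.
Qed.
End Books.

(** * Excess of red edges *)

Section Excess.
Variables (R : realFieldType) (n : nat) (c : colouring n) (p : R).
Implicit Types (X Y Q : {set 'I_n}).

(** The number of red pairs in [X * Y] beyond a density [p].  The two sets may
    overlap. *)
Definition excess X Y : R :=
  \sum_(x in X) (#|Y :&: nbr c true x|%:R - p * #|Y|%:R).

Lemma excess_sym X Y : excess X Y = excess Y X.
Proof.
rewrite /excess !sumrB -!natr_sum; congr (_%:R - _).
  by under eq_bigr => x _ do rewrite setIC; rewrite sum_card_nbr.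
by rewrite !sumr_const -[LHS]mulr_natr -[RHS]mulr_natr mulrAC.
Qed.

Lemma excess_le X Y : 0 <= p -> excess X Y <= #|X|%:R * #|Y|%:R.
Proof.
move=> p0; rewrite mulr_natl -sumr_const; apply: ler_sum => x _.
rewrite lerBlDr; apply: ler_wpDr; first by rewrite mulr_ge0.
by rewrite ler_nat subset_leq_card // subsetIl.
Qed.

Lemma excess_split X Y v : v \in X ->
  excess X Y = (#|Y :&: nbr c true v|%:R - p * #|Y|%:R)
    + (excess (X :&: nbr c true v) Y + excess (X :&: nbr c false v) Y).
Proof. exact: big_split_nbr. Qed.

Lemma excess_setD1 X Y v : v \in X ->
  excess (X :\ v) Y = excess X Y - (#|Y :&: nbr c true v|%:R - p * #|Y|%:R).
Proof. by move=> vX; rewrite {2}/excess (big_setD1 v) //= addrC addrK. Qed.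

(** The sum over [v] counts red paths of length two that start and end in [X]
    and have their midpoint in [Y]; by Cauchy-Schwarz this is at least what the
    density predicts. *)
Lemma excess_average X Y :
  excess X Y * (\sum_(v in X) #|Y :&: nbr c true v|%:R)
    <= #|Y|%:R * \sum_(v in X) excess X (Y :&: nbr c true v).
Proof.
pose D y : R := #|X :&: nbr c true y|%:R.
pose S := \sum_(y in Y) D y.
have -> : \sum_(v in X) #|Y :&: nbr c true v|%:R = S.
  rewrite /S /D -!natr_sum; congr (_%:R).
  by under eq_bigr => v _ do rewrite setIC; rewrite sum_card_nbr.
have -> : excess X Y = S - p * #|X|%:R * #|Y|%:R.
  by rewrite excess_sym /excess sumrB sumr_const -[_ *+ _]mulr_natr.
have -> : \sum_(v in X) excess X (Y :&: nbr c true v)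
    = \sum_(y in Y) D y * (D y - p * #|X|%:R).
  under eq_bigr => v _ do rewrite excess_sym.
  rewrite /excess.
  under eq_bigr => v _ do under eq_bigl => y do rewrite in_setI.
  under eq_bigr => v _ do rewrite big_mkcondr /=.
  rewrite exchange_big /=; apply: eq_bigr => y yY.
  rewrite -big_mkcondr /=.
  under eq_bigl => v do rewrite nbr_sym -in_setI.
  by rewrite sumr_const -[LHS]mulr_natl.
have -> : \sum_(y in Y) D y * (D y - p * #|X|%:R)
   = (\sum_(y in Y) D y ^+ 2) - p * #|X|%:R * S.
  rewrite /S mulr_sumr -sumrB; apply: eq_bigr => y _; ring.
suff CS : S ^+ 2 <= #|Y|%:R * \sum_(y in Y) D y ^+ 2 by lra.
have [Y0|Y0] := eqVneq Y set0.
  by rewrite /S Y0 !big_set0 cards0 mul0r expr0n.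
have cY : (0 : R) < #|Y|%:R by rewrite ltr0n card_gt0.
have : 0 <= \sum_(y in Y) (#|Y|%:R * D y - S) ^+ 2.
  by apply: sumr_ge0 => y _; exact: sqr_ge0.
have -> : \sum_(y in Y) (#|Y|%:R * D y - S) ^+ 2
   = #|Y|%:R * (#|Y|%:R * (\sum_(y in Y) D y ^+ 2) - S ^+ 2).
  have E y : (#|Y|%:R * D y - S) ^+ 2
     = #|Y|%:R ^+ 2 * D y ^+ 2 - (2 * #|Y|%:R * S) * D y + S ^+ 2 by ring.
  under eq_bigr => y _ do rewrite E.
  rewrite big_split sumrB -!mulr_sumr -/S sumr_const -[_ *+ _]mulr_natr /=; ring.
by rewrite pmulr_rge0 // subr_ge0.
Qed.

Lemma excess_self_ge (A : {set 'I_n}) be rho :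
  (forall v, v \in A -> #|A :&: nbr c false v|%:R <= be * #|A|%:R) ->
  1 <= (1 - be - p - rho) * #|A|%:R ->
  rho * #|A|%:R ^+ 2 <= excess A A.
Proof.
move=> blueA large; rewrite expr2 mulrA [leLHS]mulrC mulr_natl -sumr_const.
apply: ler_sum => v vA.
have := blueA v vA; have := congr1 (fun i => i%:R : R) (card_split_nbr c vA).
by rewrite -natr1 natrD; lra.
Qed.

End Excess.

(** * Red steps and boost steps *)

Section Branching.
Variables (R : realFieldType) (m : nat) (p P : R).
Hypotheses (P_gt0 : 0 < P) (pE : p = P ^+ m.+1) (m_gt0 : (0 < m)%N).

Let p_gt0 : 0 < p. Proof. by rewrite pE exprn_gt0. Qed.

(** A branch keeps the share [a] of the vertices and the share [A] of the
    excess, and may lose a factor [z] of potential.  If it fails, [A] lies below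
    the tangent at [a = w] of the concave function that marks success. *)
Lemma branch_bound (q w z A a : R) : 0 < q -> 0 < w -> 0 <= a -> z <= w * q ^+ m.+1 ->
  ~ (0 < A /\ z * a ^+ m <= p * A ^+ m.+1) ->
  m.+1%:R * P * A < q * (w + m%:R * a).
Proof.
move=> q0 w0 a0 zq nA.
have m0 : (0 : R) < m%:R by rewrite ltr0n.
have [A_le0|A_gt0] := leP A 0.
  apply: (@le_lt_trans _ _ 0); first by rewrite mulr_ge0_le0 // mulr_ge0 // ltW.
  by rewrite mulr_gt0 // ltr_wpDr // mulr_ge0 // ltW.
have pA : p * A ^+ m.+1 < z * a ^+ m by rewrite ltNge; apply/negP => pA; apply: nA.
have {a0}a_gt0 : 0 < a.
  rewrite lt_neqAle a0 andbT; apply/eqP => aE; move: pA.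
  by rewrite -aE expr0n gtn_eqF //= mulr0 ltNge mulr_ge0 ?exprn_ge0 ?(ltW p_gt0) ?(ltW A_gt0).
have qa0 : 0 < q * a by rewrite mulr_gt0.
have PA0 : 0 <= P * A by rewrite mulr_ge0 ?ltW.
have := expr_tangent m.+1 qa0 PA0; rewrite [(P * A) ^+ _]exprMn -pE => tan.
have am0 : 0 < a ^+ m by rewrite exprn_gt0.
have qm0 : 0 < q ^+ m by rewrite exprn_gt0.
have lt1 : (q * a) ^+ m.+1 * (1 + m.+1%:R * (P * A / (q * a) - 1)) < w * q ^+ m.+1 * a ^+ m.
  apply: le_lt_trans tan (lt_le_trans pA _); by rewrite ler_pM2r.
have E : (q * a) ^+ m.+1 * (1 + m.+1%:R * (P * A / (q * a) - 1))
   = (q ^+ m * a ^+ m) * (m.+1%:R * P * A - m%:R * q * a).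
  rewrite [in LHS]exprS exprMn -natr1; field.
  by rewrite !gt_eqF.
have {lt1} : (q ^+ m * a ^+ m) * (m.+1%:R * P * A - m%:R * q * a) < (q ^+ m * a ^+ m) * (w * q).
  by rewrite -E; apply: lt_le_trans lt1 _; rewrite exprS le_eqVlt; apply/orP; left; apply/eqP; ring.
rewrite ltr_pM2l ?mulr_gt0 //; lra.
Qed.

(** If both branches fail, [branch_bound] bounds [A] and [B] by linear functions
    of [a] and [b], tangent at [1 - mu] and [mu].  As [q <= 1], their sum is
    largest for the largest admissible [b], where it is still below
    [1 - tau]. *)
Lemma red_or_boost (q mu mu0 x tau A B a b : R) :
  0 < q <= 1 -> 0 < mu < 1 -> mu <= mu0 ->
  x <= (1 - mu) * q ^+ m.+1 -> mu0 + q * (1 - mu0) <= (1 - tau) * P ->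
  0 <= a -> 0 <= b -> a + b <= 1 -> b <= mu0 -> 1 - tau <= A + B ->
  (0 < A /\ x * a ^+ m <= p * A ^+ m.+1) \/
  (0 < B /\ mu * b ^+ m <= p * B ^+ m.+1).
Proof.
move=> /andP[q0 q1] /andP[mu_gt0 mu_lt1] mu_le xq le_P a0 b0 ab bmu AB.
have [?|nA] := boolP ((0 < A) && (x * a ^+ m <= p * A ^+ m.+1)).
  by left; apply/andP.
have [?|nB] := boolP ((0 < B) && (mu * b ^+ m <= p * B ^+ m.+1)).
  by right; apply/andP.
exfalso.
have w0 : 0 < 1 - mu by rewrite subr_gt0.
have bA : m.+1%:R * P * A < q * (1 - mu + m%:R * a).
  by apply: branch_bound xq _ => //; apply/andP.
have bB : m.+1%:R * P * B < 1 * (mu + m%:R * b).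
  apply: (@branch_bound 1 mu mu) => //; first by rewrite expr1n mulr1.
  exact/andP.
have MP : 0 <= m.+1%:R * P by rewrite mulr_ge0 // ltW.
have := ler_wpM2l MP AB.
have := ler_wpM2l (ler0n R m.+1) le_P.
have m0 : (0 : R) <= m%:R by [].
have h1 : 0 <= (1 - q) * (mu0 - mu) by rewrite mulr_ge0 // subr_ge0.
have h2 : 0 <= m%:R * ((1 - q) * (mu0 - b)) by rewrite !mulr_ge0 // subr_ge0.
have h3 : 0 <= m%:R * (q * (1 - a - b)) by rewrite !mulr_ge0 ?(ltW q0) //; lra.
rewrite -natr1; rewrite -natr1 in bA bB; lra.
Qed.

(** The step in terms of cardinals: [Z] stands for [#|X| * #|Y|], [f] for the
    excess, and [k] for the share of [Y] that is kept. *)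
Lemma rescale (K C Z z f a k A : R) : 0 <= a -> 0 <= k -> 0 < f -> 0 <= C -> 0 < A ->
  K * Z ^+ m <= z * C * f ^+ m.+1 -> z * a ^+ m <= p * A ^+ m.+1 -> p <= k ->
  K * (a * k * Z) ^+ m <= C * (A * f * k) ^+ m.+1.
Proof.
move=> a0 k0 f0 C0 A0 KZ za pk.
have am0 : 0 <= a ^+ m by rewrite exprn_ge0.
have km0 : 0 <= k ^+ m by rewrite exprn_ge0.
have -> : K * (a * k * Z) ^+ m = (a ^+ m * k ^+ m) * (K * Z ^+ m).
  by rewrite !exprMn; ring.
apply: le_trans (ler_wpM2l (mulr_ge0 am0 km0) KZ) _.
have h : 0 <= k ^+ m * C * f ^+ m.+1 by rewrite !mulr_ge0 // exprn_ge0 // ltW.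
have -> : a ^+ m * k ^+ m * (z * C * f ^+ m.+1)
   = k ^+ m * C * f ^+ m.+1 * (z * a ^+ m) by ring.
have -> : C * (A * f * k) ^+ m.+1 = k ^+ m * C * f ^+ m.+1 * (k * A ^+ m.+1).
  by rewrite !exprMn (exprS k); ring.
apply: ler_wpM2l => //; apply: le_trans za _.
by rewrite ler_wpM2r // exprn_ge0 // ltW.
Qed.
End Branching.

Lemma bin_expr_le1 (R : realFieldType) (x y : R) k l :
  0 < x -> 0 < y -> x + y <= 1 -> 'C(k + l, k)%:R * (x ^+ k * y ^+ l) <= 1.
Proof.
move=> x0 y0 xy.
apply: le_trans (_ : (y + x) ^+ (k + l) <= 1); last first.
  by rewrite exprn_ile1 //; lra.
have kl : (k < (k + l).+1)%N by rewrite ltnS leq_addr.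
rewrite exprDn (bigD1 (Ordinal kl)) //= addKn.
rewrite -[X in X <= _]addr0 lerD //; first by rewrite -[leRHS]mulr_natl [y ^+ _ * _]mulrC.
by apply: sumr_ge0 => i _; rewrite mulrn_wge0 // mulr_ge0 // exprn_ge0 // ltW.
Qed.

(** * The book argument *)

(** [x], [mu] and [y] are the factors charged for a red vertex, for a blue vertex
    taken from [X], and for a blue vertex found in [Y].  [mu0] is the threshold
    for a large blue degree and [mu1] the factor per vertex that a book of [r]
    vertices really retains; [W0] vertices of large blue degree guarantee a blue
    clique of size [b] to extract the book from.  [tau] is the relative error
    tolerated in the averaging, and [K * #|Y|] is the excess below which [X] is
    considered exhausted. *)
Section BookArgument.
Variables (R : realFieldType) (n : nat) (c : colouring n).
Variables (m r b l k0 W0 : nat) (p P q mu mu0 mu1 x y tau K : R).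
Hypotheses (m_gt0 : (0 < m)%N) (P_gt0 : 0 < P) (pE : p = P ^+ m.+1)
  (p_ge : 1 / 2 <= p).
Hypotheses (q01 : 0 < q <= 1) (mu01 : 0 < mu < 1) (mu_le : mu <= mu0)
  (x_gt0 : 0 < x) (y_gt0 : 0 < y) (xy_le1 : x + y <= 1).
Hypotheses (xq : x <= (1 - mu) * q ^+ m.+1)
  (le_P : mu0 + q * (1 - mu0) <= (1 - tau) * P).
Hypotheses (tau01 : 0 < tau <= 1) (K_ge : 8 * W0%:R <= tau * K)
  (W0P : forall k, (k <= k0)%N -> ('C(k + b, k) <= W0)%N).
Hypotheses (r_gt0 : (0 < r)%N) (r_le : (r <= b)%N) (mu1_gt0 : 0 < mu1)
  (le_mu1 : b%:R * mu1 + r%:R <= b%:R * mu0)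
  (mu1r : 4 * mu ^+ r <= mu1 ^+ r)
  (quarter : 1 / 4 <= (m%:R / m.+1%:R) ^+ m.+1 :> R).
Implicit Types (X Y : {set 'I_n}).

Let excess := excess c p.
Let deg v Y : R := #|Y :&: nbr c true v|%:R.


Let deg_le v Y : deg v Y <= #|Y|%:R.
Proof. by rewrite ler_nat subset_leq_card // subsetIl. Qed.

Let p_ge0 : 0 <= p. Proof. by apply: le_trans p_ge; lra. Qed.

Let K_ge_W0 : 8 * W0%:R <= K.
Proof.
have [tau0 tau1] := andP tau01.
have K0 : 0 <= K.
  by rewrite -(pmulr_rge0 _ tau0); apply: le_trans K_ge; rewrite mulr_ge0.
by apply: le_trans K_ge _; rewrite ler_piMl.
Qed.

Lemma excess_gt0_card X Y : 0 < excess X Y -> (0 : R) < #|X|%:R /\ (0 : R) < #|Y|%:R.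
Proof.
move=> f0; have := lt_le_trans f0 (excess_le c X Y p_ge0).
by rewrite -natrM !ltr0n muln_gt0 => /andP.
Qed.

(** The excess is at most [#|X| * #|Y|], so that a small excess [K * #|Y|] leaves
    all of the potential to [Y]. *)
Lemma small_excess X Y k t : 0 < excess X Y -> excess X Y <= K * #|Y|%:R ->
  K * (#|X|%:R * #|Y|%:R) ^+ m <= x ^+ k * mu ^+ t * y ^+ l * excess X Y ^+ m.+1 ->
  clique_in c true k Y \/ clique_in c false l Y.
Proof.
move=> f0 fK Kf; apply: erdos_szekeres.
have [N0 Z0] := excess_gt0_card f0.
have K0 : 0 < K by rewrite -(pmulr_lgt0 _ Z0); exact: lt_le_trans fK.
have [mu_gt0 mu_lt1] := andP mu01.
set xy := x ^+ k * y ^+ l; have xy0 : 0 < xy by rewrite mulr_gt0 ?exprn_gt0.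
have NZ0 : 0 < (#|X|%:R * #|Y|%:R) ^+ m :> R by rewrite exprn_gt0 ?mulr_gt0.
have fm : excess X Y ^+ m <= (#|X|%:R * #|Y|%:R) ^+ m.
  by apply: lerXn2r; rewrite ?nnegrE ?(ltW f0) ?mulr_ge0 ?excess_le.
have mut : mu ^+ t <= 1 by rewrite exprn_ile1 // ltW.
have : K * (#|X|%:R * #|Y|%:R) ^+ m
    <= (xy * #|Y|%:R) * (K * (#|X|%:R * #|Y|%:R) ^+ m).
  apply: (le_trans Kf); rewrite exprS.
  have -> : x ^+ k * mu ^+ t * y ^+ l * (excess X Y * excess X Y ^+ m)
      = xy * (mu ^+ t * (excess X Y * excess X Y ^+ m)) by rewrite /xy; ring.
  rewrite -mulrA ler_pM2l //.
  have fm0 : 0 <= excess X Y ^+ m by rewrite exprn_ge0 // ltW.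
  apply: le_trans (_ : excess X Y * excess X Y ^+ m <= _).
    by rewrite ler_piMl // mulr_ge0 // ltW.
  by rewrite mulrA [#|Y|%:R * K]mulrC ler_pM // ltW.
rewrite -[leLHS]mul1r ler_pM2r ?mulr_gt0 // => xyY.
have := le_trans (bin_expr_le1 k l x_gt0 y_gt0 xy_le1) xyY.
by rewrite mulrC ler_pM2l // ler_nat.
Qed.

(** The quantity [excess ^ (m + 1) / #|X| ^ m] does not decrease, by AM-GM, when
    a vertex whose own excess is below [m / (m + 1)] times the average is
    deleted.  Hence such vertices may be assumed absent, and then every subset
    of [X] has nearly the full density to [Y]. *)
Lemma discard_vertex X Y C v : v \in X -> 0 < excess X Y -> 0 <= C ->
  (deg v Y - p * #|Y|%:R) * #|X|%:R * m.+1%:R < m%:R * excess X Y ->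
  K * (#|X|%:R * #|Y|%:R) ^+ m <= C * excess X Y ^+ m.+1 ->
  0 < excess (X :\ v) Y /\
  K * (#|X :\ v|%:R * #|Y|%:R) ^+ m <= C * excess (X :\ v) Y ^+ m.+1.
Proof.
move=> vX f0 C0 lowv Kf; have [N0 Z0] := excess_gt0_card f0.
have M0 : (0 : R) < m.+1%:R by rewrite ltr0n.
have cX : (#|X|%:R : R) = #|X :\ v|%:R + 1 by rewrite (cardsD1 v X) vX add1n natr1.
pose z : R := #|X :\ v|%:R / #|X|%:R.
have z0 : 0 <= z by rewrite divr_ge0.
pose u := (m%:R * z + 1) / m.+1%:R.
have uE : u = 1 - m%:R / (#|X|%:R * m.+1%:R).
  by rewrite /u /z -natr1 cX; field; rewrite natr1 -cX !gt_eqF.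
have u0 : 0 < u by rewrite divr_gt0 // ltr_wpDl // mulr_ge0.
have f'u : excess X Y * u <= excess (X :\ v) Y.
  rewrite /excess excess_setD1 // uE mulrBr mulr1 lerD2l lerN2 -/excess.
  by rewrite mulrA ler_pdivlMr ?mulr_gt0 // mulrA [_ * m%:R]mulrC ltW.
have fu0 : 0 < excess X Y * u by rewrite mulr_gt0.
split; first exact: lt_le_trans f'u.
have -> : (#|X :\ v|%:R : R) = z * #|X|%:R by rewrite /z divfK ?gt_eqF.
rewrite -mulrA exprMn mulrCA.
apply: le_trans (ler_wpM2l (exprn_ge0 _ z0) Kf) _; rewrite mulrCA.
apply: ler_wpM2l => //.
apply: le_trans (_ : (excess X Y * u) ^+ m.+1 <= _); last first.
  by apply: lerXn2r; rewrite ?nnegrE // ltW // (lt_le_trans fu0).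
rewrite [(excess X Y * u) ^+ _]exprMn [z ^+ m * _]mulrC. rewrite ler_wpM2l ?exprn_ge0 ?(ltW f0) //.
exact: amgm_one.
Qed.

(** Passing to a subset of [X] may cost a factor [(m / (m + 1)) ^ (m + 1)], which
    is at least [1 / 4], however many blue vertices are gained.  Taking [r] of
    them at once recovers it, because [mu1 ^ r] is at least [4 * mu ^ r]. *)
Lemma book_step X Y (Q : {set 'I_n}) C : Q \subset X -> #|Q| = b -> monochromatic c false Q ->
  (forall s, s \in Q -> mu0 * #|X|%:R <= #|X :&: nbr c false s|%:R) ->
  (forall v, v \in X ->
     m%:R * excess X Y <= (deg v Y - p * #|Y|%:R) * #|X|%:R * m.+1%:R) ->
  0 < excess X Y -> 0 <= C ->
  K * (#|X|%:R * #|Y|%:R) ^+ m <= C * mu ^+ r * excess X Y ^+ m.+1 ->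
  exists X' : {set 'I_n}, [/\ X' \subset X,
    forall j, clique_in c false j X' -> clique_in c false (j + r) X,
    0 < excess X' Y &
    K * (#|X'|%:R * #|Y|%:R) ^+ m <= C * excess X' Y ^+ m.+1].
Proof.
move=> QX cQ mQ degQ degX f0 C0 Kf; have [N0 Z0] := excess_gt0_card f0.
have M0 : (0 : R) < m.+1%:R by rewrite ltr0n.
have m0 : (0 : R) < m%:R by rewrite ltr0n.
have [|||X' [X'X ext cX']] := large_blue_book QX mQ _ _ mu1_gt0 _ degQ (r := r).
- by rewrite cQ.
- by rewrite cQ (leq_trans r_gt0).
- by rewrite cQ.
have X'0 : (0 : R) < #|X'|%:R.
  by apply: lt_le_trans cX'; rewrite mulr_gt0 ?exprn_gt0.
pose be : R := #|X'|%:R / #|X|%:R.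
have be0 : 0 < be by rewrite divr_gt0.
have f'_ge : be * (m%:R / m.+1%:R * excess X Y) <= excess X' Y.
  have -> : be * (m%:R / m.+1%:R * excess X Y)
     = \sum_(v in X') (m%:R * excess X Y / (#|X|%:R * m.+1%:R)).
    rewrite sumr_const -[RHS]mulr_natl /be; field.
    by rewrite [1 + _]addrC natr1 !gt_eqF.
  apply: ler_sum => v /(subsetP X'X)/degX; rewrite -mulrA -ler_pdivrMr //.
  by rewrite mulr_gt0.
have g0 : 0 < m%:R / m.+1%:R * excess X Y by rewrite mulr_gt0 // divr_gt0.
have f'0 : 0 < excess X' Y by apply: lt_le_trans f'_ge; rewrite mulr_gt0.
exists X'; split=> //.
have -> : (#|X'|%:R : R) = be * #|X|%:R by rewrite /be divfK ?gt_eqF.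
rewrite -[be * _ * _]mulrA exprMn mulrCA.
apply: le_trans (ler_wpM2l (exprn_ge0 _ (ltW be0)) Kf) _.
rewrite -[C * _ * _]mulrA mulrCA; apply: ler_wpM2l => //.
apply: le_trans (_ : (be * (m%:R / m.+1%:R * excess X Y)) ^+ m.+1 <= _); last first.
  by apply: lerXn2r; rewrite ?nnegrE // ltW // mulr_gt0.
rewrite [leRHS]exprMn [be ^+ m.+1]exprSr -[be ^+ m * be * _]mulrA.
apply: ler_wpM2l; first by rewrite exprn_ge0 // ltW.
rewrite [(_ * excess X Y) ^+ _]exprMn [leRHS]mulrA.
apply: ler_wpM2r; first by rewrite exprn_ge0 // ltW.
apply: le_trans (_ : be * (1 / 4) <= _); last by rewrite ler_wpM2l // ltW.
have : mu1 ^+ r <= be by rewrite /be ler_pdivlMr.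
by move=> h; have := le_trans mu1r h; lra.
Qed.

(** The average of [excess_average] is attained outside [W] up to the relative
    error [tau]: fewer than [W0] vertices, and the contribution of [v] itself
    (the term [- deg v Y]), are negligible when the excess exceeds
    [K * #|Y|]. *)
Lemma good_vertex X Y (W : {set 'I_n}) : W \subset X -> (#|W| < W0)%N ->
  0 < excess X Y -> K * #|Y|%:R < excess X Y ->
  (forall v, v \in X -> p * #|Y|%:R <= deg v Y) ->
  exists2 v, v \in X :\: W &
    (1 - tau) * excess X Y * deg v Y
      <= #|Y|%:R * (excess X (Y :&: nbr c true v) - deg v Y).
Proof.
move=> WX cW f0 KZf degX; have [N0 Z0] := excess_gt0_card f0.
set f := excess X Y in f0 KZf *.
set N : R := #|X|%:R in N0; set Z : R := #|Y|%:R in Z0 KZf degX *.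
have [/existsP[v /andP[vX vP]]|/existsPn nov] := boolP [exists v, (v \in X :\: W) &&
    ((1 - tau) * f * deg v Y
      <= Z * (excess X (Y :&: nbr c true v) - deg v Y))]; first by exists v.
exfalso.
have [tau0 tau1] := andP tau01.
have W0_ge1 : (1 : R) <= W0%:R by rewrite ler1n (leq_ltn_trans _ cW).
have cW' : (#|W|%:R : R) + 1 <= W0%:R by rewrite natr1 ler_nat.
have KN : K < N.
  by rewrite -(ltr_pM2r Z0); apply: lt_le_trans KZf _; exact: excess_le.
pose F v := Z * excess X (Y :&: nbr c true v) - f * deg v Y.
have sumF : 0 <= \sum_(v in X) F v.
  by rewrite /F sumrB -!mulr_sumr subr_ge0; exact: excess_average.
have tauf : 8 * W0%:R * Z <= tau * f.
  apply: le_trans (ler_wpM2r (ltW Z0) K_ge) _.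
  by rewrite -mulrA ler_wpM2l ?(ltW tau0) // ltW.
have FW : \sum_(v in X :&: W) F v <= #|W|%:R * (N * Z * Z).
  rewrite (setIidPr WX) mulr_natl -sumr_const; apply: ler_sum => v vW.
  rewrite /F; apply: ler_wnDr; first by rewrite oppr_le0 mulr_ge0 // ltW.
  rewrite [leRHS]mulrC ler_wpM2l ?(ltW Z0) //.
  apply: le_trans (excess_le c _ _ p_ge0) _.
  by rewrite ler_wpM2l ?(ltW N0) //; exact: deg_le.
have FX : \sum_(v in X :\: W) F v <= #|X :\: W|%:R * - (3 * (W0%:R * Z * Z)).
  rewrite mulr_natl -sumr_const; apply: ler_sum => v vXW.
  have vX : v \in X by case/setDP: vXW.
  have := nov v; rewrite vXW /= -ltNge => lt_v.
  have dv := degX v vX; have dv0 : 0 <= deg v Y by [].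
  have pZ := ler_wpM2r (ltW Z0) p_ge.
  have h1 : tau * f * deg v Y >= 8 * W0%:R * Z * deg v Y by rewrite ler_wpM2r.
  have h2 : Z * deg v Y <= W0%:R * Z * deg v Y.
    by rewrite -mulrA ler_peMl // mulr_ge0 // ltW.
  have WZ0 : 0 <= W0%:R * Z by rewrite mulr_ge0 // ltW.
  have h3 : W0%:R * Z * Z <= W0%:R * Z * (2 * deg v Y) by rewrite ler_wpM2l //; lra.
  have h4 : 0 <= W0%:R * Z * deg v Y by rewrite mulr_ge0.
  rewrite /F; lra.
have cXW : (#|X :\: W|%:R : R) = N - #|W|%:R.
  by rewrite cardsD (setIidPr WX) natrB // subset_leq_card.
move: sumF; rewrite (big_setID W) /= => sumF.
have WZ0 : 0 < W0%:R * Z * Z by rewrite !mulr_gt0 // (lt_le_trans _ W0_ge1).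
have W_half : N / 2 <= #|X :\: W|%:R by rewrite cXW; have := K_ge_W0; lra.
have h5 := ler_wpM2r (ltW WZ0) W_half.
have h6 : #|W|%:R * (N * Z * Z) <= W0%:R * (N * Z * Z).
  by rewrite ler_wpM2r ?mulr_ge0 ?(ltW N0) ?(ltW Z0) //; lra.
have : 0 < N * (W0%:R * Z * Z) by rewrite mulr_gt0.
lra.
Qed.

Lemma branch_step X Y (W : {set 'I_n}) C1 C2 : W \subset X -> (#|W| < W0)%N ->
  (forall v, v \in X :\: W -> #|X :&: nbr c false v|%:R <= mu0 * #|X|%:R) ->
  0 < excess X Y -> K * #|Y|%:R < excess X Y ->
  (forall v, v \in X -> p * #|Y|%:R <= deg v Y) ->
  0 <= C1 -> 0 <= C2 ->
  K * (#|X|%:R * #|Y|%:R) ^+ m <= x * C1 * excess X Y ^+ m.+1 ->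
  K * (#|X|%:R * #|Y|%:R) ^+ m <= mu * C2 * excess X Y ^+ m.+1 ->
  exists2 v, v \in X & let Yv := Y :&: nbr c true v in
    (0 < excess (X :&: nbr c true v) Yv /\
     K * (#|X :&: nbr c true v|%:R * #|Yv|%:R) ^+ m
       <= C1 * excess (X :&: nbr c true v) Yv ^+ m.+1) \/
    (0 < excess (X :&: nbr c false v) Yv /\
     K * (#|X :&: nbr c false v|%:R * #|Yv|%:R) ^+ m
       <= C2 * excess (X :&: nbr c false v) Yv ^+ m.+1).
Proof.
move=> WX cW degW f0 KZf degX C1_0 C2_0 Kf1 Kf2; have [N0 Z0] := excess_gt0_card f0.
have [v vXW v_good] := good_vertex WX cW f0 KZf degX.
have vX : v \in X by case/setDP: vXW.
exists v => //=; set Yv := Y :&: nbr c true v in v_good *.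
set f := excess X Y in f0 Kf1 Kf2 v_good KZf *.
set N : R := #|X|%:R in N0 Kf1 Kf2 degW *.
set Z : R := #|Y|%:R in Z0 Kf1 Kf2 v_good KZf degX *.
pose k := deg v Y / Z.
have pk : p <= k by rewrite /k ler_pdivlMr // degX.
have p0 : 0 < p by apply: lt_le_trans p_ge; lra.
have k0_ : 0 < k by exact: lt_le_trans pk.
have Yvk : deg v Y = k * Z by rewrite /k divfK ?gt_eqF.
pose part b' := X :&: nbr c b' v.
pose A b' := excess (part b') Yv / (f * k).
pose a b' : R := #|part b'|%:R / N.
have AE b' : excess (part b') Yv = A b' * f * k.
  by rewrite -mulrA /A divfK // gt_eqF // mulr_gt0.
have aE b' : #|part b'|%:R * #|Yv|%:R = a b' * k * (N * Z).
  by rewrite -/(deg v Y) Yvk /a; field; rewrite gt_eqF.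
have a0 b' : 0 <= a b' by rewrite divr_ge0 // ltW.
have step b' z C : 0 <= C -> K * (N * Z) ^+ m <= z * C * f ^+ m.+1 ->
   0 < A b' /\ z * a b' ^+ m <= p * A b' ^+ m.+1 ->
   0 < excess (part b') Yv /\
   K * (#|part b'|%:R * #|Yv|%:R) ^+ m <= C * excess (part b') Yv ^+ m.+1.
  move=> C0 Kf [A0 zA]; split; first by rewrite AE mulr_gt0 // mulr_gt0.
  by rewrite AE aE; apply: (rescale _ _ _ _ _ Kf zA pk) => //; rewrite ?ltW.
have ab : a true + a false <= 1.
  rewrite /a -mulrDl ler_pdivrMr // mul1r -natrD ler_nat (card_split_nbr c vX).
  exact: leqnSn.
have bmu : a false <= mu0 by rewrite /a ler_pdivrMr //; apply: degW.
have AB : 1 - tau <= A true + A false.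
  have eE := excess_split c p Yv vX; rewrite -!/(part _) -!/(excess _ _) in eE.
  have ev : #|Yv :&: nbr c true v|%:R - p * #|Yv|%:R <= deg v Y.
    rewrite lerBlDr; apply: ler_wpDr; first by rewrite mulr_ge0.
    by rewrite ler_nat subset_leq_card // subsetIl.
  have fkZ : 0 < f * k * Z by rewrite mulr_gt0 // mulr_gt0.
  rewrite -(ler_pM2r fkZ); move: v_good; rewrite Yvk eE.
  have := ler_wpM2l (ltW Z0) ev; rewrite Yvk !AE; lra.
have [red|boost] := red_or_boost P_gt0 pE m_gt0 q01 mu01 mu_le xq le_P
  (a0 true) (a0 false) ab bmu AB.
  by left; apply: step Kf1 red.
by right; apply: step Kf2 boost.
Qed.

(** The induction is on [#|X| + t], since a step either deletes vertices of [X] or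
    lowers the blue target [t].  The target [l] concerns [Y] alone, where no blue
    vertex is gained before the end. *)
Lemma book_argument s X Y k t : (#|X| + t <= s)%N -> (k <= k0)%N ->
  0 < excess X Y ->
  K * (#|X|%:R * #|Y|%:R) ^+ m <= x ^+ k * mu ^+ t * y ^+ l * excess X Y ^+ m.+1 ->
  [\/ clique_in c true k (X :|: Y), clique_in c false t X | clique_in c false l Y].
Proof.
elim: s X Y k t => [|s IHs] X Y k t.
  rewrite leqn0 addn_eq0 => /andP[_ /eqP ->] *; constructor 2; exact: clique_in0.
case: k => [|k]; first by move=> *; constructor 1; apply: clique_in0.
case: t => [|t]; first by move=> *; constructor 2; apply: clique_in0.
move=> szX kk0 f0 Kf.
have [mu_gt0 mu_lt1] := andP mu01.
have coef_ge0 i j : 0 <= x ^+ i * mu ^+ j * y ^+ l.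
  by rewrite !mulr_ge0 // exprn_ge0 // ltW.
have [fK|KZf] := leP (excess X Y) (K * #|Y|%:R).
  have [red|blue] := small_excess f0 fK Kf; last by constructor 3.
  by constructor 1; apply: clique_in_sub red; exact: subsetUr.
pose low v := (deg v Y - p * #|Y|%:R) * #|X|%:R * m.+1%:R < m%:R * excess X Y.
have [/existsP[v /andP[vX lowv]]|/existsPn nolow] := boolP [exists v, (v \in X) && low v].
  have [f'0 Kf'] := discard_vertex vX f0 (coef_ge0 _ _) lowv Kf.
  have szX' : (#|X :\ v| + t.+1 <= s)%N by move: szX; rewrite (cardsD1 v X) vX.
  have X'X := subsetDl X [set v].
  case: (IHs _ _ _ _ szX' kk0 f'0 Kf') => clq; last by constructor 3.
    by constructor 1; apply: clique_in_sub clq; rewrite setUSS.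
  by constructor 2; apply: clique_in_sub clq.
have {nolow}degX v : v \in X ->
    m%:R * excess X Y <= (deg v Y - p * #|Y|%:R) * #|X|%:R * m.+1%:R.
  by move=> vX; have := nolow v; rewrite vX /= /low -leNgt.
have degX' v : v \in X -> p * #|Y|%:R <= deg v Y.
  move=> vX; have [N0 _] := excess_gt0_card f0; have NM0 : (0 : R) < #|X|%:R * m.+1%:R.
    by rewrite mulr_gt0.
  rewrite -subr_ge0 -(pmulr_lge0 _ NM0) mulrA; apply: le_trans (degX v vX).
  by rewrite mulr_ge0 // ltW.
pose W := [set v in X | mu0 * #|X|%:R <= #|X :&: nbr c false v|%:R].
have WX : W \subset X by apply/subsetP => v; rewrite inE => /andP[].
have [bigW|cW] := leqP W0 #|W|.
  have [red|[Q [QW cQ mQ]]] := erdos_szekeres c (leq_trans (W0P kk0) bigW).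
    by constructor 1; apply: clique_in_sub red; rewrite (subset_trans WX) ?subsetUl.
  have degQ u : u \in Q -> mu0 * #|X|%:R <= #|X :&: nbr c false u|%:R.
    by move=> /(subsetP QW); rewrite inE => /andP[].
  have [tr|rt] := leqP t.+1 r.
    constructor 2; apply: (clique_in_leq (leq_trans tr r_le)).
    by exists Q; rewrite (subset_trans QW WX).
  have Kf' : K * (#|X|%:R * #|Y|%:R) ^+ m
      <= x ^+ k.+1 * mu ^+ (t.+1 - r) * y ^+ l * mu ^+ r * excess X Y ^+ m.+1.
    apply: (le_trans Kf); rewrite -{1}(subnK (ltnW rt)) exprD le_eqVlt; apply/orP; left.
    by apply/eqP; ring.
  have [X' [X'X ext f'0 {}Kf']] :=
    book_step (subset_trans QW WX) cQ mQ degQ degX f0 (coef_ge0 _ _) Kf'.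
  have szX' : (#|X'| + (t.+1 - r) <= s)%N.
    rewrite -ltnS -addnS (leq_trans _ szX) // leq_add ?subset_leq_card //.
    by rewrite ltn_subrL r_gt0.
  case: (IHs _ _ _ _ szX' kk0 f'0 Kf') => clq; last by constructor 3.
    by constructor 1; apply: clique_in_sub clq; rewrite setUSS.
  by constructor 2; move/ext: clq; rewrite subnK // ltnW.
have degW v : v \in X :\: W -> #|X :&: nbr c false v|%:R <= mu0 * #|X|%:R.
  by case/setDP=> vX; rewrite inE vX /= -ltNge => /ltW.
have Kf1 : K * (#|X|%:R * #|Y|%:R) ^+ m
   <= x * (x ^+ k * mu ^+ t.+1 * y ^+ l) * excess X Y ^+ m.+1.
  by rewrite !mulrA -exprS.
have Kf2 : K * (#|X|%:R * #|Y|%:R) ^+ m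
   <= mu * (x ^+ k.+1 * mu ^+ t * y ^+ l) * excess X Y ^+ m.+1.
  apply: (le_trans Kf); rewrite le_eqVlt [mu ^+ t.+1]exprS; apply/orP; left.
  by apply/eqP; ring.
have [v vX [] [f'0 Kf']] :=
    branch_step WX cW degW f0 KZf degX' (coef_ge0 _ _) (coef_ge0 _ _) Kf1 Kf2.
  have szX' : (#|X :&: nbr c true v| + t.+1 <= s)%N.
    move: szX; rewrite (card_split_nbr c vX) addSn ltnS; apply: leq_trans.
    by rewrite leq_add2r leq_addr.
  case: (IHs _ _ _ _ szX' (ltnW kk0) f'0 Kf') => clq.
  - constructor 1; apply: (clique_in_extend (x := v) _ _ _ clq).
    + by rewrite inE vX.
    + by rewrite setUSS // subsetIl.
    + by rewrite subUset !subsetIr.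
  - by constructor 2; apply: clique_in_sub clq; exact: subsetIl.
  - by constructor 3; apply: clique_in_sub clq; exact: subsetIl.
have szX' : (#|X :&: nbr c false v| + t <= s)%N.
  move: szX; rewrite (card_split_nbr c vX) addSn ltnS; apply: leq_trans.
  by rewrite leq_add ?leq_addl ?leqnSn.
case: (IHs _ _ _ _ szX' kk0 f'0 Kf') => clq.
- by constructor 1; apply: clique_in_sub clq; rewrite setUSS // subsetIl.
- constructor 2; apply: (clique_in_extend vX _ _ clq); first exact: subsetIl.
  exact: subsetIr.
- by constructor 3; apply: clique_in_sub clq; exact: subsetIl.
Qed.
Corollary red_dense_set (A : {set 'I_n}) rho : 0 < rho -> (0 < #|A|)%N ->
  rho * #|A|%:R ^+ 2 <= excess A A ->
  K <= x ^+ k0 * mu ^+ l * y ^+ l * rho ^+ m.+1 * #|A|%:R ^+ 2 ->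
  clique_in c true k0 A \/ clique_in c false l A.
Proof.
move=> rho0 A0 rhoA KA; have [mu_gt0 _] := andP mu01.
have cA : (0 : R) < #|A|%:R by rewrite ltr0n.
have f0 : 0 < rho * #|A|%:R ^+ 2 by rewrite mulr_gt0 // exprn_gt0.
suff Kf : K * (#|A|%:R * #|A|%:R) ^+ m
    <= x ^+ k0 * mu ^+ l * y ^+ l * excess A A ^+ m.+1.
  have := book_argument (leqnn _) (leqnn k0) (lt_le_trans f0 rhoA) Kf.
  by rewrite setUid; case; [left|right|right].
apply: le_trans (_ : x ^+ k0 * mu ^+ l * y ^+ l * (rho * #|A|%:R ^+ 2) ^+ m.+1 <= _).
  have -> : x ^+ k0 * mu ^+ l * y ^+ l * (rho * #|A|%:R ^+ 2) ^+ m.+1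
     = x ^+ k0 * mu ^+ l * y ^+ l * rho ^+ m.+1 * #|A|%:R ^+ 2 * (#|A|%:R * #|A|%:R) ^+ m.
    by rewrite exprMn [(_ ^+ 2) ^+ m.+1]exprS -expr2; ring.
  by rewrite ler_wpM2r // exprn_ge0 // mulr_ge0.
rewrite ler_wpM2l ?mulr_ge0 ?exprn_ge0 // ?(ltW x_gt0) ?(ltW y_gt0) ?(ltW mu_gt0) //.
by apply: lerXn2r; rewrite ?nnegrE // ltW // (lt_le_trans f0).
Qed.

End BookArgument.

From mathcomp Require Import all_classical all_reals all_analysis.
Import Order.TTheory GRing.Theory Num.Theory.

(** * Exponential and binomial estimates *)

Section Estimates.
Variable R : realType.
Implicit Types (x z : R).

Lemma expR_ge_pow n x : (0 < n)%N -> - n%:R <= x -> (1 + x / n%:R) ^+ n <= expR x.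
Proof.
move=> n0 nx; have n0' : (0 : R) < n%:R by rewrite ltr0n.
have -> : expR x = expR (x / n%:R) ^+ n by rewrite -expRM_natl mulrC divfK ?gt_eqF.
apply: lerXn2r; rewrite ?nnegrE ?expR_ge0 ?expR_ge1Dx //.
by rewrite -(ler_pM2r n0') mul0r mulrDl mul1r divfK ?gt_eqF //; lra.
Qed.

Lemma expR_onem_le1 x : expR x * (1 - x) <= 1.
Proof.
rewrite -[leRHS](expRxMexpNx_1 x) ler_wpM2l ?expR_ge0 //; exact: expR_ge1Dx.
Qed.

Lemma expRN525 : expR (- (525 / 1000)) <= 3 / 5 :> R.
Proof.
have -> : (3 / 5 : R) = (5 / 3)^-1 by rewrite invf_div.
rewrite expRN lef_pV2 ?posrE ?expR_gt0 ?divr_gt0 //. 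
apply: (le_trans _ (expR_ge_pow (n := 16) _ _)) => //; lra.
Qed.

Lemma expR60 : expR (60 / 100) <= 184 / 100 :> R.
Proof.
have -> : (184 / 100 : R) = (100 / 184)^-1 by rewrite invf_div.
rewrite -[leLHS]invrK -expRN lef_pV2 ?posrE ?expR_gt0 ?divr_gt0 //.
apply: (le_trans _ (expR_ge_pow (n := 32) _ _)) => //; lra.
Qed.

Lemma expR02 : expR (1 / 50) <= 10205 / 10000 :> R.
Proof. by have := expR_onem_le1 (1 / 50 : R); lra. Qed.

Lemma onem_ge_exp z : z < 1 -> expR (- (z / (1 - z))) <= 1 - z.
Proof.
move=> z1; have z1' : 0 < 1 - z by lra.
rewrite expRN -[leRHS]invrK lef_pV2 ?posrE ?expR_gt0 ?invr_gt0 //.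
apply: (le_trans _ (expR_ge1Dx _)); rewrite -(ler_pM2r z1') mulVf ?gt_eqF //.
by rewrite mulrDl divfK ?gt_eqF //; lra.
Qed.

Lemma exists_nat_ge x : exists n : nat, x <= n%:R.
Proof.
exists (Num.Def.archi_bound `|x|).
by apply: le_trans (ler_norm _) (ltW (archi_boundP (normr_ge0 _))).
Qed.

Lemma pow4_le_expR (C e : R) : 0 < e ->
  exists k1 : nat, forall k, (k1 <= k)%N -> C * k%:R ^+ 4 <= expR (e * k%:R).
Proof.
move=> e0; pose D := C * (5 / e) ^+ 5.
have [k1 Dk1] := exists_nat_ge D; exists k1 => k k1k.
have Dk : D <= k%:R by apply: le_trans Dk1 _; rewrite ler_nat.
have k0 : (0 : R) <= k%:R by [].
have : (e * k%:R / 5) ^+ 5 <= expR (e * k%:R).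
  apply: (le_trans _ (expR_ge_pow (n := 5) _ _)) => //; last first.
    by apply: le_trans (_ : 0 <= _); [lra | rewrite mulr_ge0 // ltW].
  apply: lerXn2r; rewrite ?nnegrE ?divr_ge0 ?addr_ge0 ?mulr_ge0 ?(ltW e0) ?invr_ge0 //.
  by lra.
apply: le_trans.
have -> : (e * k%:R / 5) ^+ 5 = (e / 5) ^+ 5 * k%:R * k%:R ^+ 4 by ring.
rewrite ler_wpM2r ?exprn_ge0 //.
have -> : C = (e / 5) ^+ 5 * D by rewrite /D; field; rewrite gt_eqF.
by rewrite ler_wpM2l // exprn_ge0 // divr_ge0 // ltW.
Qed.

Lemma fact_ge n : n%:R ^+ n <= n`!%:R * expR n%:R :> R.
Proof.
elim: n => [|n IHn]; first by rewrite expr0 fact0 expR0 mulr1.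
have h : n.+1%:R ^+ n <= n%:R ^+ n * expR 1 :> R.
  case: n {IHn} => [|n]; first by rewrite !expr0 mul1r; apply: ltW; rewrite expR_gt1.
  have n0 : (0 : R) < n.+1%:R by rewrite ltr0n.
  have -> : expR 1 = expR (n.+1%:R^-1 : R) ^+ n.+1.
    by rewrite -expRM_natl divff ?gt_eqF.
  rewrite -exprMn; apply: lerXn2r; rewrite ?nnegrE ?mulr_ge0 ?expR_ge0 //.
  have := ler_wpM2l (ltW n0) (expR_ge1Dx (n.+1%:R^-1 : R)).
  by rewrite mulrDr divff ?gt_eqF // mulr1 natr1.
rewrite exprS factS natrM -natr1 expRD natr1 -!mulrA ler_wpM2l //.
apply: (le_trans h); rewrite mulrA ler_wpM2r ?expR_ge0 //.
Qed.

Lemma fact_le n : (0 < n)%N -> n`!%:R * expR n%:R <= expR 1 * n%:R * n%:R ^+ n :> R.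
Proof.
elim: n => // -[|n] IHn _; first by rewrite factS fact0 muln1 expr1 mul1r !mulr1.
have {}IHn := IHn isT.
set N := n.+1 in IHn *.
have N0 : (0 : R) < N.+1%:R by rewrite ltr0n.
have h : expR 1 * N%:R ^+ N.+1 <= N.+1%:R ^+ N.+1 :> R.
  have -> : expR 1 = expR (N.+1%:R^-1 : R) ^+ N.+1.
    by rewrite -expRM_natl divff ?gt_eqF.
  rewrite -exprMn; apply: lerXn2r; rewrite ?nnegrE ?mulr_ge0 ?expR_ge0 //.
  have := ler_wpM2l (expR_ge0 (N.+1%:R^-1 : R)) (expR_ge1Dx (- N.+1%:R^-1 : R)).
  rewrite -expRD subrr expR0 => h; have := ler_wpM2r (ltW N0) h.
  rewrite mul1r -mulrA mulrDl mul1r mulNr mulVf ?gt_eqF //.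
  by rewrite -[in N.+1%:R - 1]natr1 addrK.
have e1 : (0 : R) <= expR 1 by rewrite expR_ge0.
rewrite factS natrM -[in expR _]natr1 expRD.
have -> : N.+1%:R * N`!%:R * (expR N%:R * expR 1)
   = (N.+1%:R * expR 1) * (N`!%:R * expR N%:R) :> R by ring.
apply: le_trans (ler_wpM2l (mulr_ge0 (ltW N0) e1) IHn) _.
have -> : N.+1%:R * expR 1 * (expR 1 * N%:R * N%:R ^+ N)
  = (N.+1%:R * expR 1) * (expR 1 * N%:R ^+ N.+1) :> R by rewrite [N%:R ^+ N.+1]exprS; ring.
apply: le_trans (ler_wpM2l (mulr_ge0 (ltW N0) e1) h) _.
by rewrite [_ * expR 1]mulrC.
Qed.

(** Stirling up to polynomial factors.  In terms of [g = l / (k + l)] it says that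
    the binomial coefficient is at least [g ^ - l * (1 - g) ^ - k], up to the
    factor [expR 2 * k * l]. *)
Lemma bin_ge_entropy k l : (0 < k)%N -> (0 < l)%N ->
  (k + l)%:R ^+ (k + l) <= 'C(k + l, l)%:R * (expR 2 * k%:R * l%:R)
     * (k%:R ^+ k * l%:R ^+ l) :> R.
Proof.
move=> k0 l0; apply: le_trans (fact_ge _) _.
rewrite -(@bin_fact (k + l) l) ?leq_addl // addnK !natrM natrD expRD.
have -> : 'C(k + l, l)%:R * (l`!%:R * k`!%:R) * (expR k%:R * expR l%:R)
  = 'C(k + l, l)%:R * ((l`!%:R * expR l%:R) * (k`!%:R * expR k%:R)) :> R by ring.
rewrite -[leRHS]mulrA ler_wpM2l //.
have -> : expR 2 * k%:R * l%:R * (k%:R ^+ k * l%:R ^+ l)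
  = (expR 1 * l%:R * l%:R ^+ l) * (expR 1 * k%:R * k%:R ^+ k) :> R.
  by rewrite (_ : 2 = 1 + 1 :> R) // expRD; ring.
by rewrite ler_pM ?mulr_ge0 ?expR_ge0 ?fact_le.
Qed.

Lemma bin_ge_pow2 k l : (l <= k)%N -> 2 ^+ l <= 'C(k + l, l)%:R :> R.
Proof.
elim: l => [|l IHl] lk; first by rewrite expr0 bin0.
rewrite -(ler_pM2l (ltr0Sn R l)) -natrM -mul_bin_diag addnS /= natrM exprS mulrA.
apply: ler_pM => //; rewrite ?IHl ?(ltnW lk) // -natrM ler_nat.
by rewrite muln2 -addnn addSn ltnS addnC leq_add2r.
Qed.

End Estimates.

(** * The cost of a red step *)

Section Ratios.
Variable R : realFieldType.

Lemma power_jensen (th z : R) n : 0 <= th <= 1 -> 0 < z ->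
  (1 - th + th * z) ^+ n <= 1 - th + th * z ^+ n.
Proof.
case/andP=> th0 th1 z0; set w := 1 - th + th * z.
have w0 : 0 < w.
  rewrite /w; have [->|th_n1] := eqVneq th 1; first by rewrite subrr add0r mul1r.
  by rewrite ltr_pwDl ?subr_gt0 ?lt_neqAle ?th_n1 // mulr_ge0 // ltW.
have t1 := expr_tangent n w0 ler01; rewrite expr1n in t1.
have tz := expr_tangent n w0 (ltW z0).
have a1 : 0 <= 1 - th by rewrite subr_ge0.
have := lerD (ler_wpM2l a1 t1) (ler_wpM2l th0 tz); rewrite mulr1.
apply: le_trans; rewrite le_eqVlt; apply/orP; left; apply/eqP.
have -> : (1 - th) * (w ^+ n * (1 + n%:R * (1 / w - 1)))
    + th * (w ^+ n * (1 + n%:R * (z / w - 1)))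
  = w ^+ n * (1 + n%:R * ((1 - th + th * z) / w - 1)).
  by field; rewrite gt_eqF.
by rewrite -/w divff ?gt_eqF // subrr mulr0 addr0 mulr1.
Qed.

(** With [d = 1 / (m + 1)], [P = p ^ d] and [L = - ln p], the largest [q] that
    [red_or_boost] allows is about [1 - L * d / (1 - g)].  Then [u] is its rate,
    [q >= 1 - u * d], and the last bound says that [q ^ (m + 1)] is not much
    below [expR (- L / (1 - g))]. *)
Lemma ratio_lower (e g L d P : R) : 0 < e <= 1 -> 0 < g <= 2 / 5 ->
  0 < L <= 602 / 1000 -> 0 < d <= e / 512 -> 0 < P <= 1 -> 1 - L * d <= P ->
  let mu0 := g * (1 + e / 64) in
  exists q u : R, [/\ 0 < q <= 1, mu0 + q * (1 - mu0) = (1 - d * d) * P,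
    (1 - g) * q <= P - g &
    [/\ u * d < 1, 1 - u * d <= q & u / (1 - u * d) <= (L + 3 / 16 * e) / (1 - g)]].
Proof.
move=> /andP[e0 e1] /andP[g0 g1] /andP[L0 L1] /andP[d0 d1] /andP[P0 P1] P_ge mu0.
have eg := ler_wpM2l (ltW e0) g1.
have mu0_ge : g <= mu0 by rewrite /mu0 ler_peMr ?(ltW g0) //; lra.
have mu0_le : mu0 <= g + e / 160 by rewrite /mu0; lra.
clearbody mu0.
have g1' : 0 < 1 - g by lra.
have mu0' : 0 < 1 - mu0 by lra.
have dd0 : 0 < d * d by rewrite mulr_gt0.
have dd1 : d * d <= 1.
  by have d1' : d <= 1 by [lra]; have := ler_pM (ltW d0) (ltW d0) d1' d1'; rewrite mulr1.
have dP : (1 - d * d) * P <= P by rewrite ler_piMl ?(ltW P0) //; lra.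
pose q := ((1 - d * d) * P - mu0) / (1 - mu0).
have qE : mu0 + q * (1 - mu0) = (1 - d * d) * P.
  by rewrite /q divfK ?gt_eqF //; ring.
have q1 : q <= 1 by rewrite /q ler_pdivrMr //; lra.
pose u := (L + d) / (1 - mu0).
have uE : u * (1 - mu0) = L + d by rewrite /u divfK ?gt_eqF.
have u0 : 0 < u by rewrite divr_gt0 // addr_gt0.
have u1 : u <= 125 / 100 by rewrite /u ler_pdivrMr //; lra.
have q_ge : 1 - u * d <= q.
  rewrite /q ler_pdivlMr // mulrBl mul1r.
  have -> : u * d * (1 - mu0) = (L + d) * d by rewrite -uE; ring.
  have h : 0 <= 1 - d * d by lra.
  have := ler_wpM2l h P_ge; have := mulr_gt0 L0 (mulr_gt0 dd0 d0); lra.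
clearbody q u.
have ud : u * d <= e / 400 by have := ler_pM (ltW u0) (ltW d0) u1 d1; lra.
have ud0 : 0 < u * d by rewrite mulr_gt0.
have ud1 : 0 < 1 - u * d by lra.
have q0 : 0 < q by exact: lt_le_trans q_ge.
exists q, u; split=> //; first by rewrite q0.
  have : 0 <= (mu0 - g) * (1 - q) by rewrite mulr_ge0 // subr_ge0.
  lra.
split=> //; first by lra.
rewrite ler_pdivrMr // mulrAC ler_pdivlMr // -(ler_pM2r mu0').
have -> : u * (1 - g) * (1 - mu0) = (L + d) * (1 - g) by rewrite -uE; ring.
have h1 : 1 - g - e / 160 - e / 400 <= (1 - u * d) * (1 - mu0).
  have mu0_0 : 0 <= mu0 by lra.
  have := mulr_ge0 (ltW ud0) mu0_0; lra.
have G0 : 0 <= L + 3 / 16 * e by lra.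
have h2 := ler_wpM2l G0 h1.
have h4 := mulr_ge0 (ltW d0) (ltW g0).
have h5 := ler_wpM2l (ltW e0) L1; have h6 := ler_wpM2l (ltW e0) e1.
by rewrite -mulrA; lra.
Qed.

(** Since [q / P <= 1 - th * (1 - P)] with [th = g / (1 - g)], convexity gives
    [q ^ n <= p * (1 - th * (1 - p))] for [p = P ^ n], and for [p <= 1 - g] the
    left-hand side is at most [1 - 2 * g + g ^ 3]. *)
Lemma ratio_upper (g P q : R) n : 0 < g <= 2 / 5 -> 0 < P -> 0 <= q ->
  (1 - g) * q <= P - g -> P ^+ n <= 1 - g ->
  (1 - g) * q ^+ n <= 1 - 184 / 100 * g.
Proof.
move=> /andP[g0 g1] P0 q0 gq p_le; have g1' : 0 < 1 - g by lra.
set p := P ^+ n in p_le *; have p0 : 0 < p by rewrite exprn_gt0.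
apply: le_trans (_ : p * (1 - 2 * g + g * p) <= _); last first.
  clearbody p.
  have gg : g * g <= 16 / 100 by have := ler_pM (ltW g0) (ltW g0) g1 g1; lra.
  have ggg := ler_wpM2l (ltW g0) gg; have gp := ler_wpM2l (ltW g0) p_le.
  have A0 : 0 <= 1 - 2 * g + g * p by have := mulr_ge0 (ltW g0) (ltW p0); lra.
  have A1 : 1 - 2 * g + g * p <= 1 - g - g * g by lra.
  by have := ler_pM (ltW p0) A0 p_le A1; lra.
pose th := g / (1 - g).
have th01 : 0 <= th <= 1.
  by rewrite divr_ge0 ?(ltW g0) ?(ltW g1') //= ler_pdivrMr // mul1r; lra.
have q_le : q <= P * (1 - th + th * P).
  rewrite -(ler_pM2l g1'); apply: (le_trans gq).
  have -> : (1 - g) * (P * (1 - th + th * P)) = P * (1 - 2 * g + g * P).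
    by rewrite /th; field; rewrite gt_eqF.
  by have := mulr_ge0 (ltW g0) (sqr_ge0 (1 - P)); lra.
have -> : p * (1 - 2 * g + g * p) = (1 - g) * (p * (1 - th + th * p)).
  by rewrite /th; field; rewrite gt_eqF.
rewrite ler_pM2l //; apply: le_trans (_ : (P * (1 - th + th * P)) ^+ n <= _).
  by apply: lerXn2r; rewrite ?nnegrE // (le_trans q0).
rewrite exprMn -/p ler_pM2l //; exact: power_jensen.
Qed.
End Ratios.

(** The density [p] is slightly below the guaranteed [1 - expR (1 / 50) * g]; its
    form makes [- ln p] explicit in terms of [t = - ln (1 - g)]. *)
Lemma book_ratios (R : realType) (e g : R) m : 0 < e <= 1 -> 0 < g <= 2 / 5 ->
  512 <= e * m.+1%:R ->
  let p := (1 - g) * expR (- (35 / 1000 * g + e / 16)) in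
  let mu0 := g * (1 + e / 64) in
  exists P q t : R, let x := (1 - g) * q ^+ m.+1 in
  [/\ [/\ 0 < P, p = P ^+ m.+1 & 0 < q <= 1],
      mu0 + q * (1 - mu0) <= (1 - (m.+1%:R^-1) ^+ 2) * P,
      [/\ expR (- t) = 1 - g, 0 <= t <= 525 / 1000
        & expR (- (t + (t + 35 / 1000 * g + e / 4) / (1 - g))) <= x]
    & x <= 1 - 184 / 100 * g].
Proof.
move=> e01 g01 eM p mu0; have /andP[e0 e1] := e01; have /andP[g0 g1] := g01.
have g1' : 0 < 1 - g by lra.
have [t [tE t0 t1]] : exists t, [/\ expR (- t) = 1 - g, 0 <= t & t <= 525 / 1000].
  have tE : expR (- - ln (1 - g)) = 1 - g by rewrite opprK lnK.
  exists (- ln (1 - g)); split=> //.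
    by rewrite -oppr_le0 -expR_le1 tE; lra.
  by rewrite -lerN2 -ler_expR tE; apply: le_trans (expRN525 R) _; lra.
have [L LE] : exists L, L = t + 35 / 1000 * g + e / 16 by eexists.
have L01 : 0 < L <= 602 / 1000 by apply/andP; split; lra.
have M0 : (0 : R) < m.+1%:R by rewrite ltr0n.
have d01 : 0 < (m.+1%:R^-1 : R) <= e / 512.
  by apply/andP; split; [rewrite invr_gt0 | rewrite -div1r ler_pdivrMr //; lra].
have p_le : p <= 1 - g.
  rewrite /p; have h : expR (- (35 / 1000 * g + e / 16)) <= 1.
    by rewrite expR_le1 oppr_le0; lra.
  by rewrite ler_piMr ?(ltW g1').
have pE : p = expR (- L).
  by rewrite /p -tE -expRD; congr expR; rewrite LE; ring.
have [P [P01 P_ge pP]] : exists P : R,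
    [/\ 0 < P <= 1, 1 - L * m.+1%:R^-1 <= P & p = P ^+ m.+1].
  exists (expR (- (L * m.+1%:R^-1))); split.
  - rewrite expR_gt0 expR_le1 oppr_le0 mulr_ge0 ?invr_ge0 //.
    by case/andP: L01 => /ltW.
  - exact: expR_ge1Dx.
  by rewrite -expRM_natl mulrN mulrCA divff ?gt_eqF // mulr1.
clearbody p; rewrite pP in p_le.
have [q [u [q01 qE gq [ud1 q_ge u_le]]]] := ratio_lower e01 g01 L01 d01 P01 P_ge.
have /andP[P0 P1] := P01; have /andP[q0 q1] := q01.
exists P, q, t; split=> //; last exact: ratio_upper g01 P0 (ltW q0) gq p_le.
  by rewrite qE expr2.
have u0 : 0 < 1 - u * m.+1%:R^-1 by rewrite subr_gt0.
split=> //; first by rewrite t0.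
rewrite opprD expRD tE ler_pM2l //.
apply: le_trans (_ : (1 - u * m.+1%:R^-1) ^+ m.+1 <= _); last first.
  by apply: lerXn2r; rewrite ?nnegrE ?(ltW u0) // ltW.
apply: le_trans (_ : expR (- (u * m.+1%:R^-1 / (1 - u * m.+1%:R^-1))) ^+ m.+1 <= _); last first.
  by apply: lerXn2r; rewrite ?nnegrE ?expR_ge0 ?(ltW u0) // onem_ge_exp.
rewrite -expRM_natl ler_expR mulrN lerN2.
have -> : m.+1%:R * (u * m.+1%:R^-1 / (1 - u * m.+1%:R^-1)) = u / (1 - u * m.+1%:R^-1).
  by rewrite mulrA mulrCA divff ?gt_eqF // mulr1.
apply: (le_trans u_le); rewrite ler_pM2r ?invr_gt0 // LE; lra.
Qed.

(** * Choice of the constants *)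

Section Assembly.
Variable R : realType.

(** [m + 1] is even so that Bernoulli's inequality, applied to half of the
    exponent, gives the bound [1 / 4]. *)
Lemma book_sizes (e : R) : 0 < e <= 1 ->
  exists m r b : nat, [/\ [/\ (0 < m)%N, (0 < r)%N & (r <= b)%N],
    512 <= e * m.+1%:R, 1 / 4 <= (m%:R / m.+1%:R) ^+ m.+1 :> R &
    forall g, e <= g ->
      b%:R * (g * (1 + e / 128)) + r%:R <= b%:R * (g * (1 + e / 64)) /\
      4 * g ^+ r <= (g * (1 + e / 128)) ^+ r].
Proof.
move=> /andP[e0 e1].
have [m' m'P] := exists_nat_ge (256 / e); pose m := m'.*2.+1.
have mE : m.+1%:R = 2 * m'.+1%:R :> R.
  by rewrite -natrM mul2n doubleS.
have m'0 : (0 : R) < m'.+1%:R by [].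
have [r' r'P] := exists_nat_ge (384 / e); pose r := r'.+1.
have rP : 384 / e <= r%:R by apply: le_trans r'P _; rewrite ler_nat.
have [b' b'P] := exists_nat_ge (128 * r%:R / e ^+ 2); pose b := (b' + r)%N.
have bP : 128 * r%:R / e ^+ 2 <= b%:R.
  by apply: le_trans b'P _; rewrite ler_nat leq_addr.
exists m, r, b; split.
- by split=> //; exact: leq_addl.
- have : 256 <= e * m'%:R by rewrite -ler_pdivrMl // mulrC.
  by rewrite mE -natr1; lra.
- have mM : (0 : R) <= m%:R / m.+1%:R by rewrite divr_ge0.
  have -> : m.+1 = (m'.+1 * 2)%N by rewrite muln2 doubleS.
  rewrite exprM.
  have half : 1 / 2 <= (m%:R / (m'.+1 * 2)%:R) ^+ m'.+1 :> R.
    have mM' : (0 : R) <= m%:R / (m'.+1 * 2)%:R by rewrite divr_ge0.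
    apply: le_trans (bernoulli _ mM').
    have -> : m%:R = (m'.+1 * 2)%:R - 1 :> R.
      by rewrite muln2 doubleS -/m -natr1 addrK.
    rewrite natrM le_eqVlt; apply/orP; left; apply/eqP; field.
    by rewrite nat1r gt_eqF.
  by have := ler_pM _ _ half half; rewrite expr2; lra.
move=> g eg; have g0 : 0 < g by exact: lt_le_trans eg.
split.
  have : 128 * r%:R <= b%:R * e ^+ 2 by rewrite -ler_pdivrMr // exprn_gt0.
  have := ler_wpM2l (mulr_ge0 (ler0n R b) (ltW e0)) eg.
  by rewrite expr2; lra.
rewrite exprMn mulrC ler_wpM2l ?exprn_ge0 ?(ltW g0) //.
have e0' : 0 <= 1 + e / 128 by lra.
apply: le_trans (bernoulli _ e0').
by have := rP; rewrite ler_pdivrMr //; lra.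
Qed.

(** Writing all factors as exponentials, the exponent on the right is at least
    [l * (6 / 10 - 2 / 50 - 35 / 1000 - t)] minus the error [(k + l) * e / 4],
    because [k / (1 - g) = k + l] turns the cost of [k] red steps into one of
    [k + l] and because [y >= 1.84 * g >= expR (6 / 10) * g].  The bracket is
    nonnegative for [t <= 525 / 1000]. *)
Lemma entropy_bound (e x y t : R) k l : let g := l%:R / (k + l)%:R in
  (0 < k)%N -> (0 < l)%N -> expR (- t) = 1 - g -> 0 <= t <= 525 / 1000 ->
  expR (- (t + (t + 35 / 1000 * g + e / 4) / (1 - g))) <= x ->
  184 / 100 * g <= y ->
  expR (- ((k + l)%:R * e / 4))
    <= x ^+ k * g ^+ l * y ^+ l *
       (expR (- (l%:R / 50)) * 'C(k + l, l)%:R * (expR 2 * k%:R * l%:R)) ^+ 2.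
Proof.
move=> g k0 l0 tE /andP[t0 t1] x_ge y_ge.
have K0 : (0 : R) < k%:R by rewrite ltr0n.
have L0 : (0 : R) < l%:R by rewrite ltr0n.
have N0 : (0 : R) < (k + l)%:R by rewrite ltr0n addn_gt0 k0.
have gE : g * (k + l)%:R = l%:R by rewrite /g divfK ?gt_eqF.
have g'E : (1 - g) * (k + l)%:R = k%:R by rewrite mulrBl mul1r gE natrD addrK.
have g0 : 0 < g by rewrite divr_gt0.
have g'0 : 0 < 1 - g by rewrite -tE expR_gt0.
pose V : R := 'C(k + l, l)%:R * (expR 2 * k%:R * l%:R).
have V_ge : expR (t * k%:R) <= g ^+ l * V.
  have := bin_ge_entropy R k0 l0; rewrite -/V.
  rewrite -[X in X ^+ k * l%:R ^+ l]g'E -[X in _ * X ^+ l]gE.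
  have -> : V * (((1 - g) * (k + l)%:R) ^+ k * (g * (k + l)%:R) ^+ l)
    = (1 - g) ^+ k * (g ^+ l * V) * (k + l)%:R ^+ (k + l).
    by rewrite exprD !exprMn; ring.
  rewrite -[leLHS]mul1r ler_pM2r ?exprn_gt0 // -tE -expRM_natl mulrN [_ * t]mulrC.
  move=> h; have := ler_wpM2l (expR_ge0 (t * k%:R)) h.
  by rewrite mulr1 mulrA expRxMexpNx_1 mul1r.
have x_ge' : expR (- (k%:R * t) - (k + l)%:R * t - 35 / 1000 * l%:R - (k + l)%:R * e / 4)
    <= x ^+ k.
  apply: le_trans (_ : expR (- (t + (t + 35 / 1000 * g + e / 4) / (1 - g))) ^+ k <= _).
    rewrite -expRM_natl ler_expR le_eqVlt; apply/orP; left; apply/eqP.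
    have -> : k%:R * - (t + (t + 35 / 1000 * g + e / 4) / (1 - g))
      = - (k%:R * t) - (k%:R / (1 - g)) * (t + 35 / 1000 * g + e / 4).
      by field; rewrite gt_eqF.
    have -> : k%:R / (1 - g) = (k + l)%:R by rewrite -g'E mulrC mulKf // gt_eqF.
    by rewrite -gE; ring.
  by apply: lerXn2r; rewrite ?nnegrE ?expR_ge0 // (le_trans _ x_ge) ?expR_ge0.
have y_ge' : expR (6 / 10 * l%:R) * g ^+ l <= y ^+ l.
  rewrite expRM_natr -exprMn; apply: lerXn2r; rewrite ?nnegrE.
  - by rewrite mulr_ge0 ?expR_ge0 // ltW.
  - by apply: le_trans y_ge; rewrite mulr_ge0 // ltW.
  apply: le_trans y_ge; rewrite ler_wpM2r ?(ltW g0) //.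
  by apply: le_trans (expR60 R); rewrite ler_expR; lra.
set X := expR _ in x_ge'; set Y := expR _ in y_ge'.
set E := expR (- (l%:R / 50)).
have E0 : 0 <= E by exact: expR_ge0.
apply: le_trans (_ : X * Y * (E * expR (t * k%:R)) ^+ 2 <= _).
  rewrite /X /Y /E -!expRD -expRM_natl -expRD ler_expR.
  rewrite natrD; have := ler_wpM2r (ltW L0) t1; lra.
have -> : x ^+ k * g ^+ l * y ^+ l * (E * 'C(k + l, l)%:R * (expR 2 * k%:R * l%:R)) ^+ 2
   = x ^+ k * g ^+ l * y ^+ l * (E * V) ^+ 2 by rewrite /V !mulrA.
have EV : E * expR (t * k%:R) <= g ^+ l * (E * V).
  by rewrite mulrCA ler_wpM2l.
have gl0 : 0 < g ^+ l by rewrite exprn_gt0.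
have EV2 : (E * expR (t * k%:R)) ^+ 2 <= g ^+ l * g ^+ l * (E * V) ^+ 2.
  apply: le_trans (_ : (g ^+ l * (E * V)) ^+ 2 <= _); last by rewrite exprMn expr2.
  have EV0 : 0 <= E * expR (t * k%:R) by rewrite mulr_ge0 ?expR_ge0.
  by apply: lerXn2r; rewrite ?nnegrE //; exact: le_trans EV.
have XY : 0 <= X * Y by rewrite mulr_ge0 ?expR_ge0.
apply: le_trans (ler_wpM2l XY EV2) _.
have -> : X * Y * (g ^+ l * g ^+ l * (E * V) ^+ 2)
  = X * (Y * g ^+ l) * (g ^+ l * (E * V) ^+ 2) by ring.
have -> : x ^+ k * g ^+ l * y ^+ l * (E * V) ^+ 2
  = x ^+ k * y ^+ l * (g ^+ l * (E * V) ^+ 2) by ring.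
apply: ler_wpM2r; first by rewrite mulr_ge0 ?sqr_ge0 // ltW.
by apply: ler_pM => //; [exact: expR_ge0 | rewrite mulr_ge0 ?expR_ge0 // ltW].
Qed.
End Assembly.

(** Bookkeeping for the final comparison of sizes: [Z = expR (e * k)] is the
    allowed error, [V] the polynomial loss in the binomial estimate, [Eb] the
    loss in [entropy_bound], and [W * y1 <= Zq] the subexponential bound on the
    number of exceptional vertices. *)
Lemma size_suffices (R : realFieldType) (W M2 y1 rh Z Zq Eb ek Q S V a : R) :
  0 <= W -> 0 <= M2 -> 0 <= rh -> 0 < Z -> 0 < V -> 0 <= Q -> 0 <= S ->
  W * y1 <= Zq -> 8 * M2 * ek <= Z * (y1 * rh) -> Zq <= Z * Eb ->
  V ^+ 2 <= ek -> Eb <= Q * (S * V) ^+ 2 -> S * Z <= a ->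
  8 * W * M2 <= Q * rh * a ^+ 2.
Proof.
move=> W0 M0 rh0 Z0 V0 Q0 S0 WZ ekZ ZE Vek EQ Sa.
have V2 : 0 < V ^+ 2 by rewrite exprn_gt0.
have h1 : 8 * W * M2 * V ^+ 2 <= rh * Z * Zq.
  apply: le_trans (ler_wpM2l _ Vek) _; first by rewrite !mulr_ge0.
  have := ler_wpM2l W0 ekZ; have := ler_wpM2l (mulr_ge0 rh0 (ltW Z0)) WZ.
  lra.
have h2 := ler_wpM2l (mulr_ge0 rh0 (ltW Z0)) ZE.
have h3 := ler_wpM2l (mulr_ge0 rh0 (mulr_ge0 (ltW Z0) (ltW Z0))) EQ.
apply: le_trans (_ : Q * rh * (S * Z) ^+ 2 <= _); last first.
  apply: ler_wpM2l; first exact: mulr_ge0.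
  have SZ0 : 0 <= S * Z by rewrite mulr_ge0 // ltW.
  by apply: lerXn2r; rewrite ?nnegrE //; exact: le_trans Sa.
rewrite -(ler_pM2r V2); lra.
Qed.

(** * Induction on the size of the blue clique *)

Section Final.
Variable R : realType.

(** The number [10205 / 10000] is an upper bound for [expR (1 / 50)], so the last
    bound says that the guaranteed red density exceeds [p] by a surplus of order
    [e]. *)
Lemma red_density_bounds (e g : R) : 0 < e <= 1 -> 0 < g <= 2 / 5 ->
  let p := (1 - g) * expR (- (35 / 1000 * g + e / 16)) in
  [/\ 1 / 2 <= p, p <= 1 & e / 64 <= 1 - 10205 / 10000 * g - p - e / 64].
Proof.
move=> /andP[e0 e1] /andP[g0 g1] p.
have [z zE] : exists z, z = 35 / 1000 * g + e / 16 by eexists.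
have [E EE] : exists E, E = expR (- z) by eexists.
have h1 : 1 - z <= E by rewrite EE; exact: expR_ge1Dx.
have h2 : E * (1 + z) <= 1.
  by have := expR_onem_le1 (- z); rewrite opprK -EE.
have -> : p = (1 - g) * E by rewrite /p EE zE.
clear p EE.
have g1' : 0 <= 1 - g by lra.
have z0 : 0 < z by lra.
have E1 : E <= 1 by have := mulr_ge0 (le_trans (_ : 0 <= 1 - z) h1) (ltW z0); lra.
split.
- by have := ler_wpM2l g1' h1; have := mulr_ge0 (ltW g0) (ltW z0); lra.
- by have := ler_wpM2l g1' E1; lra.
have z1 : 0 < 1 + z by lra.
suff : (1 - g) * E * (1 + z) <= (1 - 10205 / 10000 * g - e / 32) * (1 + z).
  by rewrite ler_pM2r //; lra.
have := ler_wpM2l g1' h2; rewrite zE.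
have := ler_wpM2l (ltW g0) g1; have := ler_wpM2l (ltW e0) g1.
have := ler_wpM2l (ltW e0) e1; lra.
Qed.

Let bound (e : R) k l : R := expR (- (l%:R / 50) + e * k%:R) * 'C(k + l, l)%:R.

Lemma bound_ge (e : R) k l : (l <= k)%N -> expR (e * k%:R) <= bound e k l.
Proof.
move=> lk; rewrite /bound addrC expRD -mulrA ler_peMr ?expR_ge0 //.
apply: le_trans (ler_wpM2l (expR_ge0 _) (bin_ge_pow2 R lk)).
apply: le_trans (_ : expR (- (l%:R / 50)) * expR (l%:R / 50) <= _).
  by rewrite mulrC expRxMexpNx_1.
rewrite ler_wpM2l ?expR_ge0 // expRM_natl; apply: lerXn2r; rewrite ?nnegrE ?expR_ge0 //.
by rewrite -div1r; apply: le_trans (expR02 R) _; lra.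
Qed.

Lemma boundS (e : R) k l : (0 < k)%N ->
  bound e k l <= 10205 / 10000 * (l.+1%:R / (k + l.+1)%:R) * bound e k l.+1.
Proof.
move=> k0; have N0 : (0 : R) < (k + l.+1)%:R by rewrite ltr0n addnS.
have -> : bound e k l
   = expR (1 / 50) * (l.+1%:R / (k + l.+1)%:R) * bound e k l.+1.
  have binE : l.+1%:R * 'C(k + l.+1, l.+1)%:R = (k + l.+1)%:R * 'C(k + l, l)%:R :> R.
    by rewrite -!natrM -mul_bin_diag addnS.
  have cE : 'C(k + l.+1, l.+1)%:R = (k + l.+1)%:R * 'C(k + l, l)%:R / l.+1%:R :> R.
    by rewrite -binE mulrAC divff ?mul1r // gt_eqF.
  have eE : - (l%:R / 50) + e * k%:R = 1 / 50 + (- (l.+1%:R / 50) + e * k%:R).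
    by rewrite -natr1; lra.
  rewrite /bound cE eE expRD; field.
  by rewrite nat1r !gt_eqF // -natrD.
rewrite -[leLHS]mulrA -[leRHS]mulrA; apply: ler_wpM2r; last exact: expR02.
by rewrite mulr_ge0 ?divr_ge0 // mulr_ge0 // expR_ge0.
Qed.

(** The induction is on [l], inside one colouring.  A vertex with a blue
    neighbourhood as large as the bound for [l - 1] reduces [l]; without one,
    [boundS] bounds all blue degrees and [red_dense_set] applies.  For
    [l / 50 <= e * k] the bound is weaker than the binomial one, so [g] may be
    assumed to be at least [e], which makes the constants uniform. *)
Lemma ramsey_bound_in_set (e : R) : 0 < e <= 1 ->
  exists k1, forall k l, (k1 <= k)%N -> (3 * l <= 2 * k)%N ->
  forall n (c : colouring n) (A : {set 'I_n}), bound e k l <= #|A|%:R ->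
  clique_in c true k A \/ clique_in c false l A.
Proof.
move=> e01; have /andP[e0 e1] := e01.
have [m [r [b [[m0 r0 rb] eM quarter sizes]]]] := book_sizes e01.
have [y1 [y1_gt0 y1E]] : exists y1 : R, 0 < y1 /\ expR (- (e / 4)) + y1 = 1.
  exists (1 - expR (- (e / 4))); split; last by rewrite addrC subrK.
  by rewrite subr_gt0 expR_lt1 oppr_lt0 divr_gt0.
pose M2 : R := m.+1%:R ^+ 2.
have M2_gt0 : 0 < M2 by rewrite exprn_gt0.
pose rh := (e / 64) ^+ m.+1.
have rho0 : 0 < e / 64 by rewrite divr_gt0.
have rh0 : 0 < rh by rewrite exprn_gt0.
(* [C1] collects the constants of [size_suffices]; the summand [64 / e] below
   makes [#|A|] large enough for [excess_self_ge]. *)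
pose C1 := 8 * M2 * expR 4 / (y1 ^+ b * rh).
have yr0 : 0 < y1 ^+ b * rh by rewrite mulr_gt0 // exprn_gt0.
have C1_ge0 : 0 <= C1.
  by rewrite /C1 divr_ge0 ?(ltW yr0) // mulr_ge0 ?expR_ge0 // mulr_ge0 // ltW.
have [k1 k1P] := pow4_le_expR (C1 + 64 / e) e0.
exists k1.+1 => k l k1k; have k0 : (0 < k)%N by exact: leq_trans k1k.
have {k1P}Zk := k1P k (ltnW k1k).
have k4 : (1 : R) <= k%:R ^+ 4 by rewrite exprn_ege1 // ler1n.
elim: l => [|l IHl] lk n c A; first by right; apply: clique_in0.
set L := l.+1 in lk *; move=> BA.
have lk' : (L <= k)%N.
  by rewrite -(leq_pmul2l (isT : (0 < 2)%N)) (leq_trans _ lk) // leq_mul2r orbT.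
have [small|large] := leP (L%:R / 50) (e * k%:R).
  apply: erdos_szekeres; rewrite -(ler_nat R); apply: le_trans BA.
  have -> : 'C(k + L, k) = 'C(k + L, L).
    by rewrite -bin_sub ?leq_addr // addKn.
  rewrite ler_peMl // -[leLHS]expR0 ler_expR; lra.
have [/existsP[v /andP[vA]]|/existsPn nov] := boolP [exists v, (v \in A) &&
    (bound e k l <= #|A :&: nbr c false v|%:R)].
  have lk2 : (3 * l <= 2 * k)%N by apply: leq_trans lk; rewrite leq_mul2l leqnSn.
  case/(IHl lk2 n c) => clq.
    by left; apply: clique_in_sub clq; exact: finset.subsetIl.
  right; apply: (clique_in_extend vA _ _ clq); first exact: finset.subsetIl.
  exact: finset.subsetIr.
pose g : R := L%:R / (k + L)%:R.
have N0 : (0 : R) < (k + L)%:R by rewrite ltr0n addnS.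
have k0R : (0 : R) < k%:R by rewrite ltr0n.
have LR : (0 : R) < L%:R by rewrite ltr0n.
have lkR : (L%:R : R) <= k%:R by rewrite ler_nat.
have g01 : 0 < g <= 2 / 5.
  rewrite /g divr_gt0 //= ler_pdivrMr // natrD.
  by have : 3 * L%:R <= 2 * k%:R :> R; [rewrite -!natrM ler_nat | lra].
have eg : e <= g.
  by rewrite /g ler_pdivlMr // natrD; have := ler_wpM2l (ltW e0) lkR; lra.
have c0 : 0 <= 10205 / 10000 * g by case/andP: g01 => g0 _; lra.
have blueA v : v \in A -> #|A :&: nbr c false v|%:R <= 10205 / 10000 * g * #|A|%:R.
  move=> vA; have := nov v; rewrite vA /= -ltNge => /ltW small_v.
  apply: le_trans small_v (le_trans (boundS e l k0) _).
  exact: (ler_wpM2l c0 BA).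
have A_ge := le_trans (bound_ge e lk') BA.
have A_large : 64 / e <= #|A|%:R.
  apply: le_trans A_ge; apply: le_trans Zk; apply: (@le_trans _ _ (C1 + 64 / e)).
    by rewrite ler_wpDl.
  by rewrite ler_peMr // addr_ge0 // divr_ge0 // ltW.
have A0 : (0 < #|A|)%N.
  by rewrite -(ltr0n R); apply: lt_le_trans A_large; rewrite divr_gt0.
have [p_ge p_le p_gap] := red_density_bounds e01 g01.
have := book_ratios e01 g01 eM.
set p := (1 - g) * _ in p_ge p_le p_gap *; set mu0 := g * _.
move=> [P [q [t [[P0 pP q01] le_P [tE t01 x_ge] x_le]]]].
set x := (1 - g) * _ in x_ge x_le.
have gap : 1 <= (1 - 10205 / 10000 * g - p - e / 64) * #|A|%:R.
  apply: le_trans (ler_wpM2r (ler0n R #|A|) p_gap).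
  by move: A_large; rewrite ler_pdivrMr //; clear -e0; lra.
have dense := excess_self_ge blueA gap.
have [sizes1 sizes2] := sizes g eg.
have /andP[g0 g1] := g01.
have g'0 : 0 < 1 - g by rewrite -tE expR_gt0.
have /andP[q0 q1] := q01.
have x0 : 0 < x by rewrite /x mulr_gt0 // exprn_gt0.
have tau01 : 0 < (m.+1%:R^-1 : R) ^+ 2 <= 1.
  by rewrite exprn_gt0 ?invr_gt0 //= exprn_ile1 // ?invr_ge0 // invf_le1 // ler1n.
have xq : x <= (1 - g) * q ^+ m.+1 by [].
clearbody p x.
have y_ge : 184 / 100 * g <= 1 - x by rewrite lerBrDr -lerBrDl.
have y0 : 0 < 1 - x by apply: lt_le_trans y_ge; rewrite mulr_gt0.
apply: (@red_dense_set R n c m r b L k 'C(k + b, k) p P q g mu0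
  (g * (1 + e / 128)) x (1 - x) ((m.+1%:R^-1) ^+ 2) (8 * 'C(k + b, k)%:R * M2)
  m0 P0 pP p_ge q01 _ _ x0 y0 _ xq le_P tau01 _ _ r0 rb _ sizes1 sizes2 quarter
  A (e / 64) rho0 A0 dense _).
- by rewrite g0 (le_lt_trans g1) // ltr_pdivrMr // mul1r ltr_nat.
- by rewrite /mu0 ler_peMr ?(ltW g0) // lerDl divr_ge0 // ltW.
- by rewrite addrC subrK.
- by rewrite [8 * _ * _]mulrC mulrA exprVn mulVf ?mul1r // gt_eqF.
- move=> j jk; rewrite -[leqLHS]bin_sub ?leq_addr // -[leqRHS]bin_sub ?leq_addr //.
  by rewrite !addKn leq_bin2l // leq_add2r.
- by rewrite mulr_gt0 // ltr_wpDr // divr_ge0 // ltW.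
have V0 : 0 < expR 2 * k%:R * L%:R :> R by rewrite !mulr_gt0 ?expR_gt0.
have Q0 : 0 <= x ^+ k * g ^+ L * (1 - x) ^+ L.
  by rewrite !mulr_ge0 // exprn_ge0 // ltW.
have S0 : 0 <= expR (- (L%:R / 50)) * 'C(k + L, L)%:R :> R.
  by rewrite mulr_ge0 ?expR_ge0.
have h1 : 'C(k + b, k)%:R * y1 ^+ b <= expR (e / 4 * k%:R).
  have := bin_expr_le1 k b (expR_gt0 (- (e / 4))) y1_gt0 _; rewrite y1E => /(_ (lexx _)).
  move/(ler_wpM2l (expR_ge0 (e / 4 * k%:R))); rewrite mulr1; apply: le_trans.
  have -> : expR (e / 4 * k%:R) * ('C(k + b, k)%:R * (expR (- (e / 4)) ^+ k * y1 ^+ b))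
    = 'C(k + b, k)%:R * y1 ^+ b * (expR (e / 4) * expR (- (e / 4))) ^+ k.
    by rewrite expRM_natr exprMn; ring.
  by rewrite expRxMexpNx_1 expr1n mulr1.
have h2 : 8 * M2 * (expR 4 * k%:R ^+ 4) <= expR (e * k%:R) * (y1 ^+ b * rh).
  rewrite -ler_pdivrMr //; apply: le_trans Zk.
  have -> : 8 * M2 * (expR 4 * k%:R ^+ 4) / (y1 ^+ b * rh) = C1 * k%:R ^+ 4.
    by rewrite /C1 mulrA mulrAC.
  by rewrite ler_wpM2r ?exprn_ge0 // lerDl divr_ge0 // ltW.
have h3 : expR (e / 4 * k%:R) <= expR (e * k%:R) * expR (- ((k + L)%:R * e / 4)).
  rewrite -expRD ler_expR natrD; clear -e0 lkR k0R.
  have := ler_wpM2l (ltW e0) lkR; have := mulr_ge0 (ltW e0) (ltW k0R); lra.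
have h4 : (expR 2 * k%:R * L%:R) ^+ 2 <= expR 4 * k%:R ^+ 4 :> R.
  rewrite !exprMn -[expR 2 ^+ 2]expRM_natl -natrM -mulrA ler_wpM2l ?expR_ge0 //.
  rewrite (_ : 4 = 2 + 2)%N // exprD ler_wpM2l ?exprn_ge0 //.
  by apply: lerXn2r; rewrite ?nnegrE.
have h5 := entropy_bound k0 (isT : (0 < L)%N) tE t01 x_ge y_ge.
have h6 : expR (- (L%:R / 50)) * 'C(k + L, L)%:R * expR (e * k%:R) <= #|A|%:R.
  by rewrite mulrAC -expRD.
exact: (size_suffices (ler0n R _) (ltW M2_gt0) (ltW rh0) (expR_gt0 _) V0 Q0 S0
  h1 h2 h3 h4 h5 h6).
Qed.

(** [ramsey_bound_in_set] bounds the Ramsey number minus one; half of the error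
    absorbs the difference. *)
Lemma ramsey_le_bound (e : R) : 0 < e <= 1 ->
  exists k1, forall k l, (k1 <= k)%N -> (3 * l <= 2 * k)%N ->
    (ramsey k l)%:R <= bound e k l.
Proof.
move=> /andP[e0 e1].
have e2 : 0 < e / 2 <= 1 by apply/andP; split; lra.
have [k1 k1P] := ramsey_bound_in_set e2.
have [k2 k2P] := exists_nat_ge (2 / e).
exists (k1 + k2)%N => k l kk lk.
have kk1 : (k1 <= k)%N by rewrite (leq_trans _ kk) ?leq_addr.
have kk2 : (k2 <= k)%N by rewrite (leq_trans _ kk) ?leq_addl.
have lk' : (l <= k)%N.
  by rewrite -(leq_pmul2l (isT : (0 < 2)%N)) (leq_trans _ lk) // leq_mul2r orbT.
have ek : 2 / e <= k%:R by apply: le_trans k2P _; rewrite ler_nat.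
have B1 : 1 <= bound (e / 2) k l.
  apply: le_trans (bound_ge _ lk'); rewrite -[leLHS]expR0 ler_expR.
  by rewrite mulr_ge0 // divr_ge0 // ltW.
have BB : 2 * bound (e / 2) k l <= bound e k l.
  rewrite /bound mulrA ler_wpM2r //.
  have -> : - (l%:R / 50) + e * k%:R = e / 2 * k%:R + (- (l%:R / 50) + e / 2 * k%:R) by lra.
  rewrite [leRHS]expRD ler_wpM2r ?expR_ge0 //; apply: le_trans (expR_ge1Dx _).
  by move: ek; rewrite ler_pdivrMr //; lra.
have [->|R0] := posnP (ramsey k l); first by rewrite mulr_ge0 ?expR_ge0.
have [c [nred nblue]] := ramsey_pred_colouring R0.
have small : (ramsey k l).-1%:R < bound (e / 2) k l.
  rewrite ltNge; apply/negP => large.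
  have := k1P k l kk1 lk _ c [set: _]; rewrite cardsT card_ord => /(_ large).
  by case.
by rewrite -(prednK R0) -natr1; lra.
Qed.

End Final.

(** * The theorem *)

Unset Implicit Arguments.
Import numFieldNormedType.Exports.
Local Open Scope classical_set_scope.
Local Open Scope ring_scope.

Theorem theorem13p9 (R : realType) :
  exists o : nat -> R,
    ((fun k : nat => o k / k%:R) @ \oo --> (0 : R)) /\
    (forall k l : nat, l%:R <= 2 * k%:R / 3 :> R ->
      (ramsey k l)%:R
        <= expR (- (l%:R / 50) + o k) * ('C(k + l, l))%:R).
Proof.
pose f k l : R := if ramsey k l == 0 then 0 else
  ln ((ramsey k l)%:R / 'C(k + l, l)%:R) + l%:R / 50.
(* The least admissible error function; by [ramsey_le_bound] it is [o(k)]. *)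
pose o k := \big[Num.max/0]_(l < k.+1 | (3 * l <= 2 * k)%N) f k l.
have binR k l : (0 : R) < 'C(k + l, l)%:R by rewrite ltr0n bin_gt0 leq_addl.
exists o; split.
  apply/cvgrPdist_le => e e0.
  have d01 : 0 < Num.min e 1 <= 1 by rewrite lt_min e0 ltr01 ge_min lexx orbT.
  have [k1 k1P] := ramsey_le_bound d01.
  near=> k.
  have k0 : (0 : R) < k%:R by rewrite ltr0n; near: k; exists 1.
  have o0 : 0 <= o k by exact: bigmax_ge_id.
  rewrite sub0r normrN ger0_norm ?divr_ge0 // ler_pdivrMr //.
  apply: bigmax_le => [|l lk]; first by rewrite mulr_ge0 // ltW.
  rewrite /f; case: eqP => [_|/eqP r0]; first by rewrite mulr_ge0 // ltW.
  have rR : (0 : R) < (ramsey k l)%:R by rewrite ltr0n lt0n.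
  rewrite -lerBrDr -ler_expR lnK ?posrE ?divr_gt0 // ler_pdivrMr //.
  have kk1 : (k1 <= k)%N by near: k; exists k1.
  apply: le_trans (k1P _ _ kk1 lk) _; rewrite ler_wpM2r // ler_expR addrC lerD2r.
  by rewrite ler_wpM2r // ge_min lexx.
move=> k l lk.
have [->|r0] := eqVneq (ramsey k l) 0; first by rewrite mulr_ge0 ?expR_ge0.
have rR : (0 : R) < (ramsey k l)%:R by rewrite ltr0n lt0n.
have lk' : (3 * l <= 2 * k)%N.
  by rewrite -(ler_nat R) !natrM; lra.
have lk1 : (l < k.+1)%N.
  by rewrite ltnS -(leq_pmul2l (isT : (0 < 2)%N)) (leq_trans _ lk') // leq_mul2r orbT.
have : f k l <= o k.
  exact: (le_bigmax_cond _ (fun i : 'I_k.+1 => f k i) (j := Ordinal lk1)).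
rewrite /f (negPf r0) => fo.
rewrite -ler_pdivrMr // -[leLHS]lnK ?posrE ?divr_gt0 // ler_expR; lra.
Unshelve. all: by end_near.
Qed.
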